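(* Let $n\ge2$ be any integer (prime or composite), $d\ge1$, $\alpha>1$, and positive weights $\boldsymbol\gamma=\{\gamma_u\}$ with $\gamma_\emptyset=1$. Let $\mathbf z\in\mathbb U_n^d$ be obtained by the CBC algorithm in the context, and take $M=\big(S_{n,d,\alpha,\boldsymbol\gamma}(\mathbf z)\big)^{-1/2}$ in the index set $\mathcal A_d(M)$. Then for every $\lambda\in(\frac1\alpha,1]$, the lattice approximation $A_n$ satisfies $$e^{\rm wor\text{-}app}_{n,d,M}(\mathbf z;L_2)\le\sqrt2\,[S_{n,d,\alpha,\boldsymbol\gamma}(\mathbf z)]^{1/4}\le\frac{\sqrt2\,\kappa^{1/(4\lambda)}}{\varphi(n)^{1/(4\lambda)}}\bigg(\sum_{u\subseteq\{1:d\}}\max(|u|,1)\,\gamma_u^\lambda[2\zeta(\alpha\lambda)]^{|u|}\bigg)^{1/(2\lambda)},$$ with $\kappa=2^{2\alpha\lambda+1}+1$; in particular the exponent of $\varphi(n)^{-1}$ can be taken arbitrarily close to $\alpha/4$. Moreover, the constant is independent of $d$ if, for $\delta>0$ (with $\lambda=1/(\alpha-4\delta)\in(\frac1\alpha,1]$), $$\sum_{u\subset\mathbb N,\ |u|<\infty}\gamma_u^{\frac{1}{\alpha-4\delta}}\Big[2\,e^{1/e}\,\zeta\big(\tfrac{\alpha}{\alpha-4\delta}\big)\Big]^{|u|}<\infty.$$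
   Context: Notation: $\{1:d\}=\{1,\ldots,d\}$; $\zeta$ is the Riemann zeta function. Weights $\gamma_u>0$ for finite $u\subset\mathbb N$, $\gamma_\emptyset=1$. For $\mathbf h\in\mathbb Z^d$, $\mathrm{supp}(\mathbf h)=\{j:h_j\ne0\}$, $r(\mathbf h)=r_{d,\alpha,\boldsymbol\gamma}(\mathbf h)=\gamma_{\mathrm{supp}(\mathbf h)}^{-1}\prod_{j\in\mathrm{supp}(\mathbf h)}|h_j|^\alpha$, and $r'(\mathbf h)=\prod_{j\in\mathrm{supp}(\mathbf h)}|h_j|^\alpha$. Weighted Korobov space $H_d$: one-periodic functions $f\in L_2([0,1]^d)$ with absolutely convergent Fourier series $f(\mathbf x)=\sum_{\mathbf h}\hat f(\mathbf h)e^{2\pi i\mathbf h\cdot\mathbf x}$, $\hat f(\mathbf h)=\int_{[0,1]^d}f(\mathbf x)e^{-2\pi i\mathbf h\cdot\mathbf x}d\mathbf x$, with norm $\|f\|^2_{d,\alpha,\boldsymbol\gamma}=\sum_{\mathbf h\in\mathbb Z^d}|\hat f(\mathbf h)|^2r(\mathbf h)$. $\mathbb U_n=\{z\in\mathbb Z:1\le z\le n-1,\gcd(z,n)=1\}$, $\varphi(n)=|\mathbb U_n|$. For $M>0$, $\mathcal A_d(M)=\{\mathbf h\in\mathbb Z^d:r(\mathbf h)\le M\}$. Lattice approximation with generating vector $\mathbf z$: $\mathbf t_k=\{k\mathbf z/n\}$ (componentwise fractional part), $k=1,\ldots,n$, $\hat f^a(\mathbf h)=\frac1n\sum_{k=1}^nf(\mathbf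 t_k)e^{-2\pi i\mathbf h\cdot\mathbf t_k}$, $A_n(f)(\mathbf x)=\sum_{\mathbf h\in\mathcal A_d(M)}\hat f^a(\mathbf h)e^{2\pi i\mathbf h\cdot\mathbf x}$. Worst-case error: $e^{\rm wor\text{-}app}_{n,d,M}(\mathbf z;L_q)=\sup_{\|f\|_{d,\alpha,\boldsymbol\gamma}\le1}\|f-A_n(f)\|_{L_q([0,1]^d)}$. $S_{n,d,\alpha,\boldsymbol\gamma}(\mathbf z)=\sum_{\mathbf h\in\mathbb Z^d}\frac{1}{r(\mathbf h)}\sum_{\boldsymbol\ell\in\mathbb Z^d\setminus\{\mathbf0\},\ \boldsymbol\ell\cdot\mathbf z\equiv0\ (\mathrm{mod}\ n)}\frac1{r(\mathbf h+\boldsymbol\ell)}$. For $s\ge1$ and $\{\beta_u\}_{u\subseteq\{1:s\}}$: $\theta_{n,s,\alpha}(z_1,\ldots,z_s;\{\beta_u\})=\sum_{\mathbf h\in\mathbb Z^s}\sum_{\boldsymbol\ell\in\mathbb Z^s,\ \ell_s\ne0,\ \boldsymbol\ell\cdot(z_1,\ldots,z_s)\equiv0\ (\mathrm{mod}\ n)}\frac{\beta_{\mathrm{supp}(\mathbf h)}}{r'(\mathbf h)}\frac{\beta_{\mathrm{supp}(\mathbf h+\boldsymbol\ell)}}{r'(\mathbf h+\boldsymbol\ell)}$, and $T_{n,d,s,\alpha,\boldsymbol\gamma}(z_1,\ldots,z_s)=\sum_{w\subseteq\{s+1,\ldots,d\}}[2\zeta(2\alpha)]^{|w|}\theta_{n,s,\alpha}(z_1,\ldots,z_s;\{\gamma_{u\cup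 w}\}_{u\subseteq\{1:s\}})$. CBC algorithm: for $s=1,\ldots,d$, with $z_1,\ldots,z_{s-1}$ fixed, choose $z_s\in\mathbb U_n$ minimizing $T_{n,d,s,\alpha,\boldsymbol\gamma}(z_1,\ldots,z_{s-1},z_s)$. *)

(* Defs.v *)
From HB Require Import structures.
From mathcomp Require Import all_boot all_order all_algebra.
From mathcomp Require Import all_classical all_reals all_analysis.
From mathcomp Require Import complex finmap.
Set Implicit Arguments.
Unset Strict Implicit.
Unset Printing Implicit Defensive.
Import Order.TTheory GRing.Theory Num.Theory.
Local Open Scope ring_scope.
Local Open Scope classical_set_scope.

(* Coordinates are 0-based: coordinate j : 'I_d of Z^d / [0,1]^d is the
   paper's coordinate j+1.  Weights gamma are indexed by finite sets of
   naturals, {fset nat}; the coordinate set of 'I_d is {0,...,d-1}. *)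

Definition Zvec (d : nat) := {ffun 'I_d -> int}.
Definition Zadd (d : nat) (h l : Zvec d) : Zvec d := [ffun j => h j + l j].
Definition Zzero (d : nat) : Zvec d := [ffun => 0%R].

Definition supp (d : nat) (h : Zvec d) : {fset nat} :=
  [fset (val j) | j in [pred j : 'I_d | h j != 0]]%fset.

Definition fvals (d : nat) (w : {set 'I_d}) : {fset nat} :=
  [fset (val j) | j in w]%fset.

Definition rprime {R : realType} (alpha : R) (d : nat) (h : Zvec d) : R :=
  \prod_(j : 'I_d | h j != 0) ((absz (h j))%:R `^ alpha).

Definition rfun {R : realType} (alpha : R) (gamma : {fset nat} -> R)
  (d : nat) (h : Zvec d) : R :=
  (gamma (supp h))^-1 * rprime alpha h.

Definition dual_cond (n d : nat) (z : 'I_d -> nat) (l : Zvec d) : bool :=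
  (n%:Z %| \sum_(j : 'I_d) l j * (z j)%:Z)%Z.

Definition zeta {R : realType} (s : R) : R :=
  limn (fun N : nat => \sum_(1 <= k < N) ((k%:R : R) `^ (- s))).

Definition Ssum {R : realType} (n d : nat) (alpha : R)
  (gamma : {fset nat} -> R) (z : 'I_d -> nat) : \bar R :=
  \esum_(h in [set: Zvec d])
    (((rfun alpha gamma h)^-1%R)%:E *
    \esum_(l in [set l : Zvec d | l != Zzero d /\ dual_cond n z l])
       ((rfun alpha gamma (Zadd h l))^-1%R)%:E)%E.

(** theta_{n,s,alpha}(z_1..z_s; {beta_u}) ; "l_s <> 0" is the condition on
    the last (s-th, i.e. 0-based index s-1) coordinate *)
Definition theta {R : realType} (n s : nat) (alpha : R) (z : 'I_s -> nat)
  (beta : {fset nat} -> R) : \bar R :=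
  \esum_(h in [set: Zvec s])
    \esum_(l in [set l : Zvec s |
               (exists j : 'I_s, (val j).+1 = s /\ l j != 0) /\ dual_cond n z l])
       ((beta (supp h) / rprime alpha h) *
        (beta (supp (Zadd h l)) / rprime alpha (Zadd h l)))%:E.

(** T_{n,d,s,alpha,gamma}(z_1..z_s): w ranges over subsets of the paper's
    {s+1,...,d}, i.e. 0-based indices i with s <= i < d *)
Definition Tcbc {R : realType} (n d s : nat) (alpha : R)
  (gamma : {fset nat} -> R) (z : 'I_s -> nat) : \bar R :=
  (\sum_(w : {set 'I_d} | [forall i in w, (s <= val i)%N])
     ((2 * zeta (2 * alpha)) ^+ #|w|)%:E *
     theta n alpha z (fun u => gamma (u `|` fvals w)%fset))%E.

Definition inU (n c : nat) : bool := (0 < c < n)%N && coprime c n.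

Definition zpre (d : nat) (z : 'I_d -> nat) (i : 'I_d) : 'I_i.+1 -> nat :=
  fun k => z (widen_ord (ltn_ord i) k).
Arguments zpre {d} z i _.
Definition zrep (d : nat) (z : 'I_d -> nat) (i : 'I_d) (c : nat)
  : 'I_i.+1 -> nat :=
  fun k => if (nat_of_ord k == nat_of_ord i)%N then c else zpre z i k.
Arguments zrep {d} z i c _.

(** z is (a possible) output of the CBC algorithm: at step s = i+1,
    z_s in U_n minimizes T_{n,d,s}(z_1,...,z_{s-1}, . ) over U_n. *)
Definition is_CBC {R : realType} (n d : nat) (alpha : R)
  (gamma : {fset nat} -> R) (z : 'I_d -> nat) : Prop :=
  forall i : 'I_d, inU n (z i) /\
    forall c, inU n c ->
      (Tcbc n d alpha gamma (zpre z i) <= Tcbc n d alpha gamma (zrep z i c))%E.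

Local Open Scope complex_scope.

Definition ex {R : realType} (t : R) : R[i] :=
  cos (2 * pi * t) +i* sin (2 * pi * t).

Definition modC {R : realType} (w : R[i]) : R :=
  Num.sqrt (complex.Re w ^+ 2 + complex.Im w ^+ 2).

Definition dotR {R : realType} (d : nat) (h : Zvec d) (x : 'I_d -> R) : R :=
  \sum_(j : 'I_d) (h j)%:~R * x j.

Definition ocons {R : realType} (d : nat) (t : R) (y : 'I_d -> R)
  : 'I_d.+1 -> R :=
  fun i => if unlift ord0 i is Some j then y j else t.

Fixpoint iint {R : realType} (d : nat) : (('I_d -> R) -> R) -> R :=
  match d return (('I_d -> R) -> R) -> R with
  | 0 => fun g => g (fun _ => 0)
  | d'.+1 => fun g =>
      (\int[@lebesgue_measure R]_(t in `[0%R, 1%R])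
         iint (fun y => g (ocons t y)))%R
  end.

Definition fourier {R : realType} (d : nat) (f : ('I_d -> R) -> R[i])
  (h : Zvec d) : R[i] :=
  iint (fun x => complex.Re (f x * ex (- dotR h x))) +i*
  iint (fun x => complex.Im (f x * ex (- dotR h x))).

(** sum over Z^d of an absolutely summable real / complex family *)
Definition sumRZ {R : realType} (d : nat) (a : Zvec d -> R) : R :=
  fine (\esum_(h in [set: Zvec d]) (Num.max (a h) 0)%:E) -
  fine (\esum_(h in [set: Zvec d]) (Num.max (- a h) 0)%:E).
Definition sumCZ {R : realType} (d : nat) (c : Zvec d -> R[i]) : R[i] :=
  sumRZ (fun h => complex.Re (c h)) +i* sumRZ (fun h => complex.Im (c h)).

(** f : [0,1]^d (extended to R^d) -> C has an absolutely convergent Fourier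
    series which represents it everywhere (hence f is one-periodic,
    continuous, in L_2) *)
Definition abs_conv_fourier {R : realType} (d : nat)
  (f : ('I_d -> R) -> R[i]) : Prop :=
  (\esum_(h in [set: Zvec d]) (modC (fourier f h))%:E < +oo)%E /\
  forall x, f x = sumCZ (fun h => fourier f h * ex (dotR h x)).

Definition knorm2 {R : realType} (alpha : R) (gamma : {fset nat} -> R)
  (d : nat) (f : ('I_d -> R) -> R[i]) : \bar R :=
  \esum_(h in [set: Zvec d])
     ((modC (fourier f h)) ^+ 2 * rfun alpha gamma h)%:E.

Definition tpt {R : realType} (n d : nat) (z : 'I_d -> nat) (k : nat)
  : 'I_d -> R :=
  fun j => let y : R := (k%:R * (z j)%:R / n%:R)%R in
           (y - (Num.floor y)%:~R)%R.

Definition fhat_a {R : realType} (n d : nat) (z : 'I_d -> nat)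
  (f : ('I_d -> R) -> R[i]) (h : Zvec d) : R[i] :=
  (n%:R)^-1 * \sum_(1 <= k < n.+1) f (tpt n z k) * ex (- dotR h (tpt n z k)).

Definition An {R : realType} (n d : nat) (alpha : R)
  (gamma : {fset nat} -> R) (M : R) (z : 'I_d -> nat)
  (f : ('I_d -> R) -> R[i]) (x : 'I_d -> R) : R[i] :=
  sumCZ (fun h => if (rfun alpha gamma h <= M)%R
                  then fhat_a n z f h * ex (dotR h x) else 0).

Definition L2norm {R : realType} (d : nat) (g : ('I_d -> R) -> R[i]) : R :=
  Num.sqrt (iint (fun x => modC (g x) ^+ 2)).

Definition wce_app {R : realType} (n d : nat) (alpha : R)
  (gamma : {fset nat} -> R) (M : R) (z : 'I_d -> nat) : \bar R :=
  ereal_sup [set (L2norm (fun x => f x - An n alpha gamma M z f x))%:E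
            | f in [set f : ('I_d -> R) -> R[i] |
                      abs_conv_fourier f /\ (knorm2 alpha gamma f <= 1)%E]].

Definition wsum {R : realType} (alpha : R) (gamma : {fset nat} -> R)
  (d : nat) (lambda : R) : R :=
  \sum_(u : {set 'I_d})
     (maxn #|u| 1)%:R * gamma (fvals u) `^ lambda *
     (2 * zeta (alpha * lambda)) ^+ #|u|.

(* Main.v *)
Require Import Defs.
From HB Require Import structures.
From mathcomp Require Import all_boot all_order all_algebra.
From mathcomp Require Import all_classical all_reals all_analysis.
From mathcomp Require Import complex finmap.
From mathcomp Require Import lra ring zify.
Set Implicit Arguments.
Unset Strict Implicit.
Unset Printing Implicit Defensive.
Import Order.TTheory GRing.Theory Num.Theory.
Import numFieldNormedType.Exports.
Local Open Scope ring_scope.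
Local Open Scope classical_set_scope.

(** Put [b = 1 / r].  For the error bound, the Fourier coefficients of
    [f - A_n f] are those of [f] outside the index set, and minus the aliased
    sums [sum_(l <> 0 dual) fhat (h + l)] inside it.  Weighting by [r] and
    applying Cauchy-Schwarz, the squared L2 error is at most
    [1 / M + M * S = 2 * sqrt S].  Only [int |g|^2 <= sum |c_h|^2] is needed for
    [g = sum_h c_h e(h.x)]: it follows from uniform approximation by
    trigonometric polynomials.

    For the bound on [S], splitting the dual vectors by their last nonzero
    coordinate gives [S = sum_i T_i].  Since [z_i] minimizes [T_i],
    [totient n * T_i^lambda] is at most the sum over the units [c] of the
    [lambda]-powers of all terms of [T_i].  With [s = alpha * lambda], the number
    of units [c] solving [l * c + a = 0 mod n] is at most [gcd (l, n)], and
    vanishes unless [gcd (l, n) = gcd (a, n)]; hence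
    [sum_(l <> 0) |l|^-s #{c} <= 2 zeta s].  As
    [|k|^-s |m|^-s <= 2^s |m - k|^-s (|k|^-s + |m|^-s)], the sum for
    coordinate [i] is at most [2^(s+1)] times the sum of [b^lambda(p) b^lambda(q)]
    over all [p], [q] with [p_i <> 0] or [q_i <> 0].  Summing over [i] counts each
    pair at most [|supp p| + |supp q|] times, which gives the factor
    [2^(s+2) <= kappa]. *)

(** * Sums of nonnegative families *)

Section esum_extra.
Context {R : realType}.
Implicit Types (T U : choiceType).

(** Sums of nonnegative terms live in the extended reals, so they can be exchanged, sliced and
    reindexed before anything is known to converge; that S is finite comes out last, from the bound
    itself.

    The power lambda is there for the rate: averaging over the units bounds T_i^lambda, not T_i, by
    a multiple of 1 / totient n, hence S by a multiple of (totient n)^(-1/lambda). The price is that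
    the decay exponent alpha drops to alpha * lambda, which must stay above 1.

    For composite n the obstacle is that l * c + a = 0 mod n may have several unit solutions c. The
    choice of c acts on coordinate i alone: with p and q = p + l frozen off that coordinate, a is
    constant, and what remains is a double sum over the two integers p_i and q_i.

    On the analytic side nothing is proved about measurability of the error function: its squared
    modulus is squeezed under a trigonometric polynomial plus a constant, whose iterated integral is
    computed exactly. Signed sums over Z^d are handled through one estimate: a finite partial sum is
    off by at most the tail of a dominating series. *)

Lemma fsum_seq T (X : set T) (a : T -> \bar R) : finite_set X ->
  exists2 s : seq T, uniq s /\ {subset s <= X} &
    (\sum_(x \in X) a x = \sum_(x <- s) a x)%E.
Proof.
move=> finX; exists (fset_set X); last by rewrite fsbig_finite.
by split => // x; rewrite in_fset_set.
Qed.

Lemma esum_le_seq T (a : T -> \bar R) (C : \bar R) :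
  (forall s : seq T, uniq s -> \sum_(x <- s) a x <= C)%E ->
  (\esum_(x in [set: T]) a x <= C)%E.
Proof.
move=> H; apply: ge_ereal_sup => _ [X [finX _]] <-.
by have [s [us _] ->] := fsum_seq a finX; exact: H.
Qed.

Lemma seq_le_esum T (a : T -> \bar R) (s : seq T) : uniq s ->
  (\sum_(x <- s) a x <= \esum_(x in [set: T]) a x)%E.
Proof.
move=> us; apply: esum_ge; exists [set` s]; first by split => //; exact: finite_seq.
by rewrite fsbig_seq.
Qed.

(** One inequality, valid for every scalar, suffices: applied to [c^-1] and the family [c * a] it
    yields the converse. The sum may be infinite. *)
Lemma esumZl T (I : set T) (c : R) (a : T -> \bar R) : 0 <= c ->
  (forall x, I x -> 0 <= a x)%E ->
  (\esum_(x in I) (c%:E * a x) = c%:E * \esum_(x in I) a x)%E.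
Proof.
move=> c0 a0.
have main (k : R) (f : T -> \bar R) : 0 <= k -> (forall x, I x -> 0 <= f x)%E ->
    (\esum_(x in I) (k%:E * f x) <= k%:E * \esum_(x in I) f x)%E.
  move=> k0 f0; apply: ge_ereal_sup => _ [X [finX XI]] <-.
  have [s [us sX] eX] := fsum_seq (fun x => k%:E * f x)%E finX.
  rewrite eX big_seq -ge0_sume_distrr; last first.
    by move=> x xs; apply: f0; apply: XI; apply: set_mem; exact: sX.
  rewrite -big_seq; apply: lee_pmul => //.
    by rewrite big_seq; apply: sume_ge0 => x xs; apply/f0/XI/set_mem/sX.
  apply: esum_ge; exists [set` s]; last by rewrite fsbig_seq.
  by split; [exact: finite_seq | move=> x /= /sX /set_mem /XI].
move: c0; rewrite le_eqVlt => /predU1P[<-|c0].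
  by rewrite mul0e esum1// => x _; rewrite mul0e.
apply/eqP; rewrite eq_le; apply/andP; split; first by apply: main => //; exact: ltW.
have /main : 0 <= c^-1 by rewrite invr_ge0 ltW.
move=> /(_ (fun x => c%:E * a x)%E) H.
rewrite -lee_pdivlMl// -[leLHS](@eq_esum _ _ _ (fun x => c^-1%:E * (c%:E * a x)))%E.
  by apply: H => x Ix; apply: mule_ge0; [rewrite lee_fin ltW|exact: a0].
by move=> x _; rewrite muleA -EFinM mulVf ?gt_eqF// mul1e.
Qed.

Lemma esum_exchange T U (I : set T) (J : set U) (a : T -> U -> \bar R) :
  (forall x y, I x -> J y -> 0 <= a x y)%E ->
  (\esum_(x in I) \esum_(y in J) a x y = \esum_(y in J) \esum_(x in I) a x y)%E.
Proof.
move=> a0; rewrite !esum_esum//; last by move=> *; exact: a0.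
rewrite (@reindex_esum _ _ _ (J `*`` fun=> I) _ (fun p => (p.2, p.1)))//.
split=> [[x y] [/= ? ?]|[x y] [x' y'] _ _ [-> ->]//|[x y] [/= ? ?]]; first by split.
by exists (y, x).
Qed.

Lemma esum_reindex_bij T U (e : T -> U) (a : U -> \bar R) : bijective e ->
  (\esum_(x in [set: U]) a x = \esum_(x in [set: T]) a (e x))%E.
Proof.
move=> [f ef fe]; apply: reindex_esum; split=> // [x y _ _ /(can_inj ef)//|y _].
by exists (f y).
Qed.

Lemma esum_only T (x0 : T) (a : T -> \bar R) : (0 <= a x0)%E ->
  (forall x, x != x0 -> a x = 0)%E -> (\esum_(x in [set: T]) a x = a x0)%E.
Proof.
move=> a0 H; rewrite -[RHS](esum_set1 a0) [RHS]esum_mkcond; apply: eq_esum => x _.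
case: ifPn => // /negP xx; apply: H; apply/eqP => e; apply: xx.
exact: mem_set.
Qed.

Lemma le_esum_subset T (I J : set T) (a : T -> \bar R) : I `<=` J ->
  (forall x, J x -> 0 <= a x)%E ->
  (\esum_(x in I) a x <= \esum_(x in J) a x)%E.
Proof.
move=> IJ a0; rewrite esum_mkcond [leRHS]esum_mkcond; apply: le_esum => x _.
case: ifPn => [/set_mem/IJ xJ|_]; first by rewrite mem_set.
by case: ifPn => // /set_mem/a0.
Qed.

Lemma esum_indicator T (I : set T) (P : pred T) (a : T -> R) :
  (forall x, I x <-> P x) ->
  (\esum_(x in I) (a x)%:E = \esum_(x in [set: T]) ((P x)%:R * a x)%:E)%E.
Proof.
move=> IP; rewrite esum_mkcond; apply: eq_esum => x _.
case: ifPn => [/set_mem/IP ->|/negP nI]; first by rewrite mul1r.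
by case: (boolP (P x)) => [/IP/mem_set//|_]; rewrite mul0r.
Qed.

Lemma esum_partition_fin (J : finType) T (I : set T) (f : T -> J) (a : T -> \bar R) :
  (forall x, I x -> 0 <= a x)%E ->
  (\esum_(x in I) a x = \sum_(j : J) \esum_(x in I `&` [set x | f x = j]) a x)%E.
Proof.
move=> a0.
under [RHS]eq_bigr do rewrite esum_mkcondr.
rewrite -esum_sum; last by move=> x j /a0 ax _; case: ifP.
apply: eq_esum => x Ix; rewrite (bigD1 (f x))//= mem_set// big1 ?adde0// => j jx.
by case: ifPn => // /set_mem /= fj; rewrite fj eqxx in jx.
Qed.

Lemma esum_mul_real T U (a : T -> R) (b : U -> R) (A B : R) :
  (forall x, 0 <= a x) -> (forall y, 0 <= b y) ->
  (\esum_(x in [set: T]) (a x)%:E = A%:E)%E -> (\esum_(y in [set: U]) (b y)%:E = B%:E)%E ->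
  (\esum_(x in [set: T]) \esum_(y in [set: U]) (a x * b y)%:E = (A * B)%:E)%E.
Proof.
move=> a0 b0 hA hB.
rewrite (eq_esum (b := fun x => (B%:E * (a x)%:E)%E)).
  rewrite esumZl// ?hA -?EFinM 1?mulrC//; last by move=> x _; rewrite lee_fin.
  by rewrite -lee_fin -hB esum_ge0// => y _; rewrite lee_fin.
move=> x _; under eq_esum do rewrite EFinM.
by rewrite esumZl; [rewrite hB muleC|exact: a0|move=> y _; rewrite lee_fin].
Qed.

End esum_extra.

(** * Powers with exponent at most one, and Cauchy-Schwarz *)

Section power_sums.
Context {R : realType}.

(** The fractions [x / (x + y)] and [y / (x + y)] add up to 1 and lie in [0, 1], where every t
    satisfies t <= t^l. *)
Lemma powR_subadd (l x y : R) : 0 < l <= 1 -> 0 <= x -> 0 <= y ->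
  (x + y) `^ l <= x `^ l + y `^ l.
Proof.
move=> /andP[l0 l1] x0 y0.
have [xy0|] := leP (x + y) 0.
  have -> : x = 0 by lra.
  have -> : y = 0 by lra.
  by rewrite addr0 powR0 ?addr0// gt_eqF.
move=> xy.
have key t : 0 <= t -> t <= x + y -> t / (x + y) * (x + y) `^ l <= t `^ l.
  move=> t0 tl; rewrite -[t in leRHS](divfK (lt0r_neq0 xy)).
  rewrite powRM ?divr_ge0// ?(ltW xy)// ler_wpM2r ?powR_ge0//.
  move: t0; rewrite le_eqVlt => /predU1P[<-|t0]; first by rewrite mul0r powR_ge0.
  by apply: ger1_powR => //; rewrite divr_gt0//= ler_pdivrMr// mul1r.
have -> : (x + y) `^ l = x / (x + y) * (x + y) `^ l + y / (x + y) * (x + y) `^ l.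
  by rewrite -mulrDl -mulrDl divff ?mul1r// gt_eqF.
by rewrite lerD// key//; lra.
Qed.

Lemma poweR_le_sum (T : Type) (l : R) (s : seq T) (a : T -> \bar R) : 0 < l <= 1 ->
  (forall x, 0 <= a x)%E ->
  (poweR (\sum_(x <- s) a x) l <= \sum_(x <- s) poweR (a x) l)%E.
Proof.
move=> /andP[l0 l1] a0.
elim: s => [|x s IH]; first by rewrite !big_nil poweR0r ?gt_eqF.
rewrite !big_cons.
apply: (@le_trans _ _ (poweR (a x) l + poweR (\sum_(j <- s) a j)%E l)%E); last first.
  exact: leeD2l.
have := a0 x; have : (0 <= \sum_(j <- s) a j)%E by apply: sume_ge0.
case: (\sum_(j <- s) a j)%E => [y| |]//.
- case: (a x) => [w| |]// y0 w0.
    by rewrite -EFinD /= -EFinD lee_fin powR_subadd ?l0.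
  by rewrite addye// [poweR +oo l]eqy_poweR// leey.
- move=> _ ax; rewrite addey; last by rewrite gt_eqF// (lt_le_trans _ ax)// ltNy0.
  rewrite eqy_poweR// addey ?leey//.
  by rewrite gt_eqF// (lt_le_trans _ (poweR_ge0 _ _))// ltNy0.
Qed.

(** Passing to the supremum is done on the side without the power: each finite sum is at most
    Y^(1/l), hence so is the whole sum, and raising to the power l gives the claim. *)
Lemma poweR_esum_le (T : choiceType) (l : R) (a : T -> R) : 0 < l <= 1 ->
  (forall x, 0 <= a x) ->
  (poweR (\esum_(x in [set: T]) (a x)%:E) l <= \esum_(x in [set: T]) (a x `^ l)%:E)%E.
Proof.
move=> l01 a0; have /andP[l0 l1] := l01.
set Y := (\esum_(x in _) (a x `^ l)%:E)%E.
have Y0 : (0 <= Y)%E by apply: esum_ge0 => x _; rewrite lee_fin powR_ge0.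
have H : (\esum_(x in [set: T]) (a x)%:E <= poweR Y l^-1)%E.
  apply: esum_le_seq => s us.
  rewrite -[leLHS]poweRe1; last by apply: sume_ge0 => x _; rewrite lee_fin.
  rewrite -(divff (lt0r_neq0 l0)) poweRrM.
  apply: gt0_ler_poweR; rewrite ?invr_ge0 ?(ltW l0)//.
  - by rewrite in_itv /= poweR_ge0 leey.
  - by rewrite in_itv /= Y0 leey.
  apply: le_trans (poweR_le_sum _ l01 _) _; first by move=> x; rewrite lee_fin.
  exact: seq_le_esum.
rewrite -[leRHS]poweRe1// -(mulVf (lt0r_neq0 l0)) poweRrM.
apply: gt0_ler_poweR; rewrite ?(ltW l0)//.
- by rewrite in_itv /= esum_ge0 ?leey// => x _; rewrite lee_fin.
- by rewrite in_itv /= poweR_ge0 leey.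
Qed.

(** The product of the two finite sums is symmetrised into the double sum of (p x q y + p y q x) /
    2. By the inequality of arithmetic and geometric means each term dominates a x a y, because (a x
    a y)^2 <= (p x q y)(p y q x). *)
Lemma esum_cauchy_schwarz (T : choiceType) (a p q : T -> R) (A B v : R) :
  (forall x, 0 <= a x) -> (forall x, 0 <= p x) -> (forall x, 0 <= q x) ->
  (forall x, a x ^+ 2 <= p x * q x) ->
  (\esum_(x in [set: T]) (p x)%:E <= A%:E)%E ->
  (\esum_(x in [set: T]) (q x)%:E <= B%:E)%E ->
  (\esum_(x in [set: T]) (a x)%:E = v%:E)%E -> v ^+ 2 <= A * B.
Proof.
move=> a0 p0 q0 apq hA hB hv.
have v0 : 0 <= v by rewrite -lee_fin -hv; apply: esum_ge0 => x _; rewrite lee_fin.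
have fin s : uniq s -> (\sum_(x <- s) a x) ^+ 2 <= A * B.
  move=> us.
  have sA : \sum_(x <- s) p x <= A.
    by rewrite -lee_fin (le_trans _ hA)// -sumEFin seq_le_esum.
  have sB : \sum_(x <- s) q x <= B.
    by rewrite -lee_fin (le_trans _ hB)// -sumEFin seq_le_esum.
  apply: (@le_trans _ _ ((\sum_(x <- s) p x) * (\sum_(x <- s) q x))); last first.
    by apply: ler_pM => //; apply: sumr_ge0.
  have E2 : (\sum_(x <- s) p x) * (\sum_(x <- s) q x) =
      \sum_(x <- s) \sum_(y <- s) (p x * q y + p y * q x) / 2.
    have E1 : (\sum_(x <- s) p x) * (\sum_(x <- s) q x) =
        \sum_(x <- s) \sum_(y <- s) p x * q y by rewrite big_distrlr.
    have E3 : (\sum_(x <- s) p x) * (\sum_(x <- s) q x) =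
        \sum_(x <- s) \sum_(y <- s) p y * q x by rewrite E1 exchange_big.
    under [RHS]eq_bigr do rewrite -mulr_suml big_split /=.
    by rewrite -mulr_suml big_split /= -E1 -E3; field.
  rewrite E2 expr2 big_distrlr /=.
  apply: ler_sum => x _; apply: ler_sum => y _.
  have u0 : 0 <= p x * q y by rewrite mulr_ge0.
  have w0 : 0 <= p y * q x by rewrite mulr_ge0.
  rewrite -(@ler_pXn2r _ 2)// ?nnegrE ?mulr_ge0 ?addr_ge0//.
  rewrite exprMn; apply: le_trans (ler_pM (sqr_ge0 _) (sqr_ge0 _) (apq x) (apq y)) _.
  rewrite [leLHS](_ : _ = (p x * q y) * (p y * q x)); last by ring.
  rewrite -subr_ge0 [leRHS](_ : _ = ((p x * q y - p y * q x) / 2) ^+ 2); last by field.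
  exact: sqr_ge0.
have AB0 : 0 <= A * B by have := fin [::] isT; rewrite big_nil expr0n.
suff : v <= Num.sqrt (A * B).
  by move=> h; rewrite -(sqr_sqrtr AB0) ler_pXn2r ?nnegrE ?sqrtr_ge0.
rewrite -lee_fin -hv; apply: esum_le_seq => s us; rewrite sumEFin lee_fin.
by rewrite -(@ler_pXn2r _ 2) ?nnegrE ?sqrtr_ge0 ?sumr_ge0// sqr_sqrtr// fin.
Qed.

End power_sums.

(** * Zeta sums and slices of Z^d *)

Section zeta_sums.
Context {R : realType}.

(* [zpow s 0 = 0] for [s != 0], because [0 `^ x = 0] for [x != 0]. *)
Definition zpow (s : R) (k : int) : R := (absz k)%:R `^ (- s).

Lemma zpow_ge0 s k : 0 <= zpow s k. Proof. exact: powR_ge0. Qed.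

Lemma zpow0 s : s != 0 -> zpow s 0 = 0.
Proof. by move=> s0; rewrite /zpow powR0// oppr_eq0. Qed.

Lemma zpow_gt0 s k : k != 0 -> 0 < zpow s k.
Proof. by move=> k0; rewrite powR_gt0// ltr0n absz_gt0. Qed.

Lemma zpowN s k : zpow s (- k) = zpow s k.
Proof. by rewrite /zpow abszN. Qed.

(** A discrete integral comparison. Divided by (k+1)^(-e) it reads e / (k+1) <= ((k+1)/k)^e - 1,
    which follows from exp t >= 1 + t and ln ((k+1)/k) >= 1 / (k+1). *)
Lemma powR_telescope_bound (e : R) (k : nat) : 0 < e -> (0 < k)%N ->
  e * k.+1%:R `^ (- (e + 1)) <= k%:R `^ (- e) - k.+1%:R `^ (- e).
Proof.
move=> e0 k0.
have kp : 0 < k%:R :> R by rewrite ltr0n.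
have k1p : 0 < k.+1%:R :> R by rewrite ltr0n.
have lnle : (k.+1%:R)^-1 <= ln (k.+1%:R / k%:R) :> R.
  have h : ln (k%:R / k.+1%:R) <= k%:R / k.+1%:R - 1 :> R.
    rewrite [X in ln X](_ : _ = 1 + (k%:R / k.+1%:R - 1)); last by ring.
    by apply: le_ln1Dx; rewrite -subr_gt0 opprK subrK divr_gt0.
  rewrite -(invf_div k%:R) lnV ?posrE ?divr_gt0// lerNr (le_trans h)//.
  rewrite -[k.+1]addn1 natrD -subr_le0.
  have -> : k%:R / (k%:R + 1) - 1 - - (k%:R + 1)^-1 = 0 :> R.
    by field; rewrite gt_eqF// addr_gt0.
  by [].
rewrite opprD powRD; last by rewrite (gt_eqF k1p) implybT.
have -> : k%:R `^ (- e) = k.+1%:R `^ (- e) * (k.+1%:R / k%:R) `^ e :> R.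
  rewrite powRM ?invr_ge0 ?ler0n// mulrA -powRD ?addNr ?powRr0 ?mul1r; last first.
    by rewrite eqxx gt_eqF.
  by rewrite -powR_inv1 ?ler0n// -powRrM mulN1r.
rewrite powR_inv1 ?ler0n// mulrCA -[X in _ - X]mulr1 -mulrBr ler_wpM2l ?powR_ge0//.
rewrite /powR gt_eqF ?divr_gt0// lerBrDl.
apply: le_trans (expR_ge1Dx _); rewrite lerD2l.
by rewrite ler_wpM2l ?(ltW e0).
Qed.

Lemma zeta_partial_bound (s : R) N : 1 < s ->
  \sum_(0 <= k < N) (k%:R `^ (- s)) <= 1 + (s - 1)^-1.
Proof.
move=> s1; have e0 : 0 < s - 1 by rewrite subr_gt0.
have sN0 : - s != 0 by rewrite oppr_eq0 gt_eqF// (lt_trans _ s1).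
have [|N1] := ltnP N 2.
  case: N => [|[|//]] _; rewrite ?big_nil ?big_nat1 ?powR0//.
    by rewrite addr_ge0// invr_ge0 ltW.
  by rewrite addr_ge0// invr_ge0 ltW.
rewrite -(subnKC N1); move: (N - 2)%N => m.
(* The telescoping remainder has to be kept for the induction; it is nonnegative and dropped
   afterwards. *)
suff : \sum_(0 <= k < 2 + m) (k%:R `^ (- s)) <=
   1 + (s - 1)^-1 * (1 - (m.+1)%:R `^ (- (s - 1))).
  move=> /le_trans; apply; rewrite lerD2l -[leRHS]mulr1 ler_wpM2l ?invr_ge0 ?(ltW e0)//.
elim: m => [|m IH].
  by rewrite addn0 big_nat_recr// big_nat1 powR0//= add0r !powR1 subrr mulr0 addr0.
rewrite addnS big_nat_recr//=.
apply: le_trans (lerD IH (lexx _)) _.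
rewrite -addrA lerD2l -lerBrDl -mulrBr ler_pdivlMl//.
have := @powR_telescope_bound (s - 1) m.+1 e0 isT.
rewrite subrK => /le_trans; apply; lra.
Qed.

(** [zeta] is a [limn], which is meaningful only once the partial sums converge; their uniform bound
    supplies the summability. The index 0 contributes nothing, since 0^(-s) = 0 here. *)
Lemma esum_nat_zeta (s : R) : 1 < s ->
  (\esum_(k in [set: nat]) (k%:R `^ (- s))%:E = (zeta s)%:E)%E.
Proof.
move=> s1.
have sN0 : - s != 0 by rewrite oppr_eq0 gt_eqF// (lt_trans _ s1).
have f0 (k : nat) : (0 <= (k%:R `^ (- s) : R)%:E)%E by rewrite lee_fin powR_ge0.
have sm : summable xpredT (fun k : nat => (k%:R `^ (- s) : R)%:E).
  rewrite /summable (eq_esum (b := fun k : nat => (k%:R `^ (- s) : R)%:E)); last first.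
    by move=> k _; rewrite gee0_abs.
  rewrite -nneseries_esum//.
  apply: (@le_lt_trans _ _ (1 + (s - 1)^-1)%:E); last by rewrite ltry.
  apply: lime_le; first exact: is_cvg_nneseries.
  by apply: nearW => N; rewrite sumEFin lee_fin zeta_partial_bound.
rewrite -nneseries_esumT// summable_nneseries_lim//.
congr (_%:E); rewrite /zeta.
suff -> : (fun N => \sum_(0 <= k < N) fine (k%:R `^ (- s))%:E) =
   (fun N : nat => \sum_(1 <= k < N) ((k%:R : R) `^ (- s))) by [].
apply/funext => -[|N]; first by rewrite !big_geq.
by rewrite big_nat_recl//= powR0// add0r [RHS]big_add1.
Qed.

Lemma esum_int_zeta (s : R) : 1 < s ->
  (\esum_(k in [set: int]) (zpow s k)%:E = (2 * zeta s)%:E)%E.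
Proof.
move=> s1.
have sN0 : s != 0 by rewrite gt_eqF// (lt_trans _ s1).
rewrite (esumID [set k : int | 0 <= k]); last by move=> k _; rewrite lee_fin zpow_ge0.
rewrite !setTI mulr_natl mulr2n EFinD; congr (_ + _)%E.
  rewrite (@reindex_esum _ nat _ [set: nat] _ Posz).
    by rewrite esum_nat_zeta.
  split=> [k _ //=|k l _ _ [->]//|[k|k] //= _]; by exists k.
(* The negative integers are the opposites of the nonzero naturals; the index 0 can be put back
   because [zpow s 0 = 0]. *)
rewrite (@reindex_esum _ nat _ [set m | m != 0%N] _ (fun m => - m%:Z)).
  rewrite esum_mkcond -esum_nat_zeta//; apply: eq_esum => k _.
  case: ifPn => [_|]; first by rewrite zpowN.
  move=> /negP k0; case: (eqVneq k 0%N) => [->|k1]; last by case: k0; apply/mem_set.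
  by rewrite -[RHS]/((zpow s 0)%:E) zpow0.
split=> [k /= k0|k l _ _ /oppr_inj [->]//|k /= k0].
  by apply/negP; rewrite -ltNge oppr_lt0; case: k k0.
exists (absz k); last by move: k0; case: k.
by case: k k0.
Qed.

Lemma zeta_ge0 (s : R) : 1 < s -> 0 <= zeta s.
Proof.
move=> s1; rewrite -lee_fin -esum_nat_zeta//.
by apply: esum_ge0 => k _; rewrite lee_fin powR_ge0.
Qed.

End zeta_sums.

Section slices.
Context {R : realType} (d : nat).
Implicit Types (p t : Zvec d) (i : 'I_d).

Definition zupd p i (k : int) : Zvec d := [ffun j => if j == i then k else p j].

Definition zsupp p : {set 'I_d} := [set j | p j != 0]%SET.

Lemma zupdE p i k j : zupd p i k j = if j == i then k else p j.
Proof. by rewrite ffunE. Qed.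

Lemma zupd_id p i k : zupd p i k i = k.
Proof. by rewrite ffunE eqxx. Qed.

Lemma zupdK p i k l : zupd (zupd p i k) i l = zupd p i l.
Proof. by apply/ffunP => j; rewrite !zupdE; case: eqP. Qed.

Lemma zupd_same p i : zupd p i (p i) = p.
Proof. by apply/ffunP => j; rewrite zupdE; case: eqP => [->|]. Qed.

Lemma in_zsupp p j : (j \in zsupp p) = (p j != 0).
Proof. by rewrite inE. Qed.

Lemma supp_fvals p : supp p = fvals (zsupp p).
Proof.
apply/fsetP => x; apply/idP/idP => /imfsetP[j /= jp ->]; apply/imfsetP; exists j => //=.
  by rewrite in_zsupp.
by move: jp; rewrite in_zsupp.
Qed.

(** Each line parallel to axis [i] is represented by its point with vanishing [i]-th coordinate. *)
Lemma esum_slice i (F : Zvec d -> \bar R) : (forall p, 0 <= F p)%E ->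
  (\esum_(p in [set: Zvec d]) F p =
   \esum_(p in [set p : Zvec d | p i = 0%R]) \esum_(k in [set: int]) F (zupd p i k))%E.
Proof.
move=> F0; rewrite esum_esum//.
apply: reindex_esum; split=> //=.
  move=> [p k] [q l] /set_mem[/= p0 _] /set_mem[/= q0 _] /= e.
  have kl : k = l by rewrite -[LHS](zupd_id p i) e zupd_id.
  by rewrite -[p](zupd_same p i) -[q](zupd_same q i) p0 q0 -(zupdK p i k) e zupdK kl.
move=> p _; exists (zupd p i 0, p i); first by split => //=; rewrite zupd_id.
by rewrite /= zupdK zupd_same.
Qed.

(** Induction on the size of the support: deleting one element [i] of [w] splits off an independent
    sum over the nonzero values of coordinate [i]. *)
Lemma esum_zsupp_prod (v : int -> R) (Z : R) (w : {set 'I_d}) :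
  (forall k, 0 <= v k) -> v 0 = 0 ->
  (\esum_(k in [set: int]) (v k)%:E = Z%:E)%E ->
  (\esum_(t in [set t | zsupp t = w]) (\prod_(j | t j != 0) v (t j))%:E
    = (Z ^+ #|w|)%:E)%E.
Proof.
move=> v0 v00 hZ.
move cw : #|w| => c.
elim: c w cw => [|c IH] w cw.
  move/eqP: cw; rewrite cards_eq0 => /eqP ->.
  rewrite [X in esum X _](_ : _ = [set Zzero d]).
    rewrite esum_set1 ?expr0 big1// => j; by rewrite ffunE eqxx.
  apply/seteqP; split=> t /=.
    move=> t0; apply/ffunP => j; rewrite ffunE; apply/eqP/negPn/negP.
    by rewrite -in_zsupp t0 inE.
  by move=> ->; apply/setP => j; rewrite in_zsupp ffunE eqxx inE.
have [i iw] : exists i, i \in w by apply/set0Pn; rewrite -card_gt0 cw.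
rewrite (@reindex_esum _ _ _ ([set t | zsupp t = (w :\ i)%SET] `*`` fun=> [set k | k != 0])
    _ (fun tk => zupd tk.1 i tk.2)); last first.
  split.
  - move=> [t k] [/= tw k0]; apply/setP => j; rewrite in_zsupp zupdE.
    have [->|ji] := eqVneq j i; first by rewrite k0 iw.
    by rewrite -in_zsupp tw !inE ji.
  - move=> [p k] [q l] /set_mem[/= pw _] /set_mem[/= qw _] /= e.
    have p0 : p i = 0.
      by apply/eqP/negPn; rewrite -in_zsupp pw !inE eqxx.
    have q0 : q i = 0.
      by apply/eqP/negPn; rewrite -in_zsupp qw !inE eqxx.
    have kl : k = l by rewrite -[LHS](zupd_id p i) e zupd_id.
    by rewrite -[p](zupd_same p i) -[q](zupd_same q i) p0 q0 -(zupdK p i k) e zupdK kl.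
  - move=> p /= pw; exists (zupd p i 0, p i); last by rewrite /= zupdK zupd_same.
    split => /=; last by have := iw; rewrite -pw in_zsupp.
    apply/setP => j; rewrite in_zsupp zupdE !inE.
    by case: (eqVneq j i) => [_|_] /=; rewrite ?eqxx// -pw in_zsupp.
have := esum_esum (I := [set t | zsupp t = (w :\ i)%SET]) (J := fun=> [set k : int | k != 0])
  (a := fun t k => (\prod_(j | zupd t i k j != 0) v (zupd t i k j))%:E).
move=> <-; last by move=> t k _ _; rewrite lee_fin prodr_ge0.
rewrite exprSr EFinM -(IH (w :\ i)%SET); last first.
  by have := cardsD1 i w; rewrite iw cw add1n => -[].
rewrite muleC -esumZl; last 2 first.
- by rewrite -lee_fin -hZ esum_ge0// => k _; rewrite lee_fin.
- by move=> t _; rewrite lee_fin prodr_ge0.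
apply: eq_esum => t /= tw.
have t0 : t i = 0 by apply/eqP/negPn; rewrite -in_zsupp tw !inE eqxx.
rewrite muleC -hZ -esumZl ?prodr_ge0//; last by move=> k _; rewrite lee_fin.
(* Because [v 0 = 0], the sum over nonzero [k] is the full sum [Z]. *)
rewrite [LHS]esum_mkcond; apply: eq_esum => k _.
case: ifPn => [/set_mem /= k0|kn]; last first.
  case: (eqVneq k 0) => [->|k0]; first by rewrite v00 mule0.
  by move: kn; rewrite mem_set.
rewrite (bigD1 i) ?zupd_id//= -EFinM mulrC; congr (_ * _)%:E.
apply: eq_big => [j|j]; rewrite zupdE; case: (eqVneq j i) => [->|ji];
  by rewrite ?t0 ?eqxx ?andbT ?andbF.
Qed.

End slices.

(** * Unit solutions of linear congruences *)

Section unit_solutions.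
Variable n : nat.

Definition nsol (l a : int) : nat :=
  (\sum_(c < n | inU n c) (n%:Z %| (l * c%:Z + a)%R)%Z)%N.

(** Multiplying [l] by a unit does not change its gcd with [n], and l * c = -a mod n has the same
    gcd with [n] as [a]. *)
Lemma nsol_neq0_gcd l a : nsol l a != 0%N -> gcdn (absz l) n = gcdn (absz a) n.
Proof.
rewrite /nsol sum_nat_eq0 negb_forall => /existsP[c].
rewrite negb_imply eqb0 negbK => /andP[/andP[_ cop]] dv.
have dvg (g : int) : (g %| n%:Z)%Z -> (g %| l * c%:Z + a)%Z by move/dvdz_trans; apply.
apply/eqP; rewrite eqn_dvd !dvdn_gcd !dvdn_gcdr !andbT.
apply/andP; split.
  have gl : ((gcdn (absz l) n)%:Z %| l)%Z by rewrite dvdzE absz_nat dvdn_gcdl.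
  have := dvg (gcdn (absz l) n)%:Z; rewrite dvdzE !absz_nat dvdn_gcdr => /(_ isT).
  by rewrite rpredDl ?dvdz_mulr// dvdzE absz_nat.
have ga : ((gcdn (absz a) n)%:Z %| a)%Z by rewrite dvdzE absz_nat dvdn_gcdl.
have := dvg (gcdn (absz a) n)%:Z; rewrite dvdzE !absz_nat dvdn_gcdr => /(_ isT).
rewrite rpredDr// dvdzE abszM !absz_nat Gauss_dvdl//.
apply: coprime_dvdl (dvdn_gcdr _ _) _.
by rewrite coprime_sym.
Qed.

(* All solutions agree modulo [n %/ gcdn l n]. *)
Lemma nsol_le_gcd l a : (0 < n)%N -> (nsol l a <= gcdn (absz l) n)%N.
Proof.
move=> n0; set g := gcdn _ _.
have g0 : (0 < g)%N by rewrite gcdn_gt0 n0 orbT.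
have gn : (g %| n)%N by exact: dvdn_gcdr.
have gl : (g %| absz l)%N by exact: dvdn_gcdl.
pose n' := (n %/ g)%N.
have n'0 : (0 < n')%N by rewrite divn_gt0// dvdn_leq.
pose P := [set c : 'I_n | inU n c && (n%:Z %| l * c%:Z + a)%Z]%SET.
have -> : nsol l a = #|P|.
  rewrite /nsol -sum1_card big_mkcond [RHS]big_mkcond; apply: eq_bigr => c _.
  by rewrite inE; case: inU => //=; case: (_ %| _)%Z.
(* Quotients by [n'] take at most [g] values. Two solutions with equal quotients also share the
   remainder, hence coincide. *)
pose f (c : 'I_n) : 'I_g.-1.+1 := inord (c %/ n').
have finj : {in P &, injective f}.
  move=> c c'; rewrite !inE => /andP[_ dc] /andP[_ dc'] /(congr1 val) /=.
  have fb (b : 'I_n) : (b %/ n' < g)%N.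
    by rewrite ltn_divLR// /n' mulnC divnK// ltn_ord.
  rewrite !inordK ?prednK// => e.
  have : (n%:Z %| l * (c%:Z - c'%:Z))%Z.
    by rewrite (_ : _ * _ = (l * c%:Z + a) - (l * c'%:Z + a)) ?rpredB//; ring.
  rewrite dvdzE abszM absz_nat -{1}(divnK gn) -{1}(divnK gl) mulnC -mulnA [X in (_ %| X)%N]mulnCA.
  rewrite dvdn_pmul2l// Gauss_dvdr; last first.
    by rewrite coprime_sym /coprime -(@eqn_pmul2r g)// muln_gcdl !divnK// mul1n.
  move=> dvc; apply/val_inj => /=.
  have : (c = c' %[mod n'])%N.
    apply/eqP; move: dvc; rewrite -/n'.
    case: (leqP c' c) => [h|/ltnW h]; first by rewrite subzn// eqn_mod_dvd.
    by rewrite -opprB abszN subzn// eq_sym eqn_mod_dvd.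
  by move=> em; rewrite (divn_eq c n') (divn_eq c' n') e em.
rewrite -(card_in_imset finj) (leq_trans (max_card _))// card_ord prednK//.
Qed.

End unit_solutions.

(** * Sums over one pair of integer coordinates, averaged over the units *)

Section lattice_average.
Context {R : realType} (n : nat) (s : R).
Hypotheses (n0 : (0 < n)%N) (s1 : 1 < s).

Let s0 : s != 0. Proof. by rewrite gt_eqF// (lt_trans _ s1). Qed.

(** With g = gcd (a, n), only multiples l = g m contribute, each with at most g units. The total
    weight g (g |m|)^(-s) = g^(1-s) |m|^(-s) is at most |m|^(-s) because s > 1. *)
Lemma esum_zpow_nsol a :
  (\esum_(l in [set: int]) (zpow s l * (nsol n l a)%:R)%:E <= (2 * zeta s)%:E)%E.
Proof.
set g := gcdn (absz a) n.
have g0 : (0 < g)%N by rewrite gcdn_gt0 n0 orbT.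
rewrite -esum_int_zeta//.
apply: (@le_trans _ _ (\esum_(l in [set l : int | (g%:Z %| l)%Z]) (zpow s l * g%:R)%:E)%E).
  rewrite [leRHS]esum_mkcond; apply: le_esum => l _.
  have [->|nz] := eqVneq (nsol n l a) 0%N.
    by rewrite mulr0; case: ifP => //; rewrite lee_fin mulr_ge0 ?zpow_ge0.
  have eg := nsol_neq0_gcd nz.
  rewrite mem_set; last by rewrite /= dvdzE absz_nat -[g]eg dvdn_gcdl.
  by rewrite lee_fin ler_wpM2l ?zpow_ge0// ler_nat -[g]eg nsol_le_gcd.
rewrite (@reindex_esum _ _ _ [set: int] _ (fun m => g%:Z * m)).
  apply: le_esum => m _; rewrite lee_fin /zpow abszM absz_nat natrM powRM//.
  rewrite mulrAC ler_piMl ?powR_ge0// -[X in _ * X]powRr1// -powRD; last first.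
    by rewrite pnatr_eq0 -lt0n g0 implybT.
  rewrite -[leRHS](powRr0 g%:R) ler_powR ?ler1n//.
  by rewrite addrC subr_le0 ltW.
split=> [m _ /=|m m' _ _|l /= /dvdzP[q ->]]; first by rewrite dvdz_mulr.
  by move=> /mulfI; apply; rewrite eqz_nat -lt0n.
by exists q => //; rewrite mulrC.
Qed.

(** The larger of |k| and |m| is at least |m - k| / 2, so its power is at most 2^s |m - k|^(-s). For
    [k = m] the right side would vanish, as [zpow s 0 = 0]. *)
Lemma zpow_mul_le (k m : int) : k != m ->
  zpow s k * zpow s m <= 2 `^ s * zpow s (m - k) * (zpow s k + zpow s m).
Proof.
move=> km.
have half (j : int) : j != 0 -> (absz (m - k) <= 2 * absz j)%N ->
    zpow s j <= 2 `^ s * zpow s (m - k).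
  move=> j0 h; rewrite /zpow !powRN.
  rewrite -ler_pdivrMl ?powR_gt0// -invfM -powRM// lef_pV2 ?posrE; last 2 first.
  - by rewrite powR_gt0// mulr_gt0// ltr0n absz_gt0.
  - by rewrite powR_gt0// ltr0n absz_gt0 subr_eq0 eq_sym.
  apply: ge0_ler_powR; rewrite ?nnegrE ?ler0n ?mulr_ge0//.
    by rewrite ltW// (lt_trans _ s1).
  by rewrite -natrM ler_nat.
have nn j : 0 <= zpow s j by exact: zpow_ge0.
have p2 : 0 <= 2 `^ s :> R by exact: powR_ge0.
have [k0|k0] := eqVneq k 0.
  by rewrite {1}k0 zpow0// mul0r !mulr_ge0// addr_ge0.
have [m0|m0] := eqVneq m 0.
  by rewrite {1}m0 zpow0// mulr0 !mulr_ge0// addr_ge0.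
rewrite mulrDr.
case: (leqP (absz m) (absz k)) => h.
  apply: (@le_trans _ _ (2 `^ s * zpow s (m - k) * zpow s m)).
    by rewrite ler_wpM2r// half//; lia.
  by rewrite lerDr !mulr_ge0.
apply: (@le_trans _ _ (2 `^ s * zpow s (m - k) * zpow s k)).
  by rewrite mulrC ler_wpM2r// half//; lia.
by rewrite lerDl !mulr_ge0.
Qed.

(** The shape of a product weight along a line: [x0] is its value at coordinate 0 and [x1] its value
    at coordinate 1, since [zpow s 1 = 1]. *)
Definition slice (x0 x1 : R) (k : int) : R := if k == 0 then x0 else x1 * zpow s k.

Lemma esum2D (T U : choiceType) (f g : T -> U -> R) :
  (forall x y, 0 <= f x y) -> (forall x y, 0 <= g x y) ->
  (\esum_(x in [set: T]) \esum_(y in [set: U]) (f x y + g x y)%:E =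
   \esum_(x in [set: T]) \esum_(y in [set: U]) (f x y)%:E +
   \esum_(x in [set: T]) \esum_(y in [set: U]) (g x y)%:E)%E.
Proof.
move=> f0 g0; rewrite -esumD.
- apply: eq_esum => x _; rewrite -esumD => [|y _|y _]; rewrite ?lee_fin//.
- by move=> x _; apply: esum_ge0 => y _; rewrite lee_fin.
- by move=> x _; apply: esum_ge0 => y _; rewrite lee_fin.
Qed.

Lemma esumZl_real (T : choiceType) (c : R) (f : T -> R) : 0 <= c -> (forall x, 0 <= f x) ->
  (\esum_(x in [set: T]) (c * f x)%:E = c%:E * \esum_(x in [set: T]) (f x)%:E)%E.
Proof. by move=> c0 f0; rewrite -esumZl// => x _; rewrite lee_fin. Qed.

(** The right-hand double sum is explicit: x0 y1 Z + x1 y0 Z + x1 y1 Z^2. On the left the terms with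
    exactly one zero coordinate give at most the first two summands. The terms with both coordinates
    nonzero give two double sums, each at most 2^s x1 y1 Z^2; together they produce the factor
    2^(s+1). *)
Lemma slice_sum_nsol_le (x0 x1 y0 y1 : R) (a : int) :
  0 <= x0 -> 0 <= x1 -> 0 <= y0 -> 0 <= y1 ->
  (\esum_(k in [set: int]) \esum_(m in [set: int])
     ((k != m)%:R * (slice x0 x1 k * slice y0 y1 m * (nsol n (m - k) a)%:R))%:E <=
   (2 `^ (s + 1))%:E * \esum_(k in [set: int]) \esum_(m in [set: int])
     (((k != 0) || (m != 0))%:R * (slice x0 x1 k * slice y0 y1 m))%:E)%E.
Proof.
move=> hx0 hx1 hy0 hy1.
set Z := 2 * zeta s.
have Z0 : 0 <= Z by rewrite mulr_ge0// zeta_ge0.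
pose N l : R := (nsol n l a)%:R.
have N0 l : 0 <= N l by rewrite /N ler0n.
have v0 k : 0 <= zpow s k by exact: zpow_ge0.
have p2 : 0 <= 2 `^ s :> R by exact: powR_ge0.
have hN : (\esum_(l in [set: int]) (zpow s l * N l)%:E <= Z%:E)%E by exact: esum_zpow_nsol.
have hZ : (\esum_(l in [set: int]) (zpow s l)%:E = Z%:E)%E by exact: esum_int_zeta.
clearbody Z.
have q1 : 1 <= 2 `^ (s + 1) :> R.
  by rewrite -[leLHS](powRr0 2) ler_powR ?ler1n// addr_ge0// ltW// (lt_trans _ s1).
have -> : (\esum_(k in [set: int]) \esum_(m in [set: int])
     (((k != 0) || (m != 0))%:R * (slice x0 x1 k * slice y0 y1 m))%:E =
   (x0 * y1 * Z + x1 * y0 * Z + x1 * y1 * (Z * Z))%:E)%E.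
  transitivity (\esum_(k in [set: int]) \esum_(m in [set: int])
     ((k == 0)%:R * (x0 * y1 * zpow s m) + (m == 0)%:R * (x1 * y0 * zpow s k)
       + x1 * y1 * (zpow s k * zpow s m))%:E)%E.
    apply: eq_esum => k _; apply: eq_esum => m _; congr (_%:E).
    rewrite /slice; case: (eqVneq k 0) => [->|k0]; case: (eqVneq m 0) => [->|m0] /=;
      rewrite ?zpow0//; ring.
  rewrite esum2D; last 2 first.
  - by move=> k m; rewrite addr_ge0// !mulr_ge0.
  - by move=> k m; rewrite !mulr_ge0.
  rewrite esum2D; last 2 first.
  - by move=> k m; rewrite !mulr_ge0.
  - by move=> k m; rewrite !mulr_ge0.
  rewrite !EFinD; congr (_ + _ + _)%E.
  - rewrite (@esum_only _ _ 0) => [||k k0]; last 2 first.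
    + by apply: esum_ge0 => m _; rewrite lee_fin !mulr_ge0.
    + by apply: esum1 => m _; rewrite (negbTE k0) mul0r.
    by under eq_esum do rewrite mul1r; rewrite esumZl_real ?hZ ?mulr_ge0.
  - rewrite esum_exchange; last by move=> k m _ _; rewrite lee_fin !mulr_ge0.
    rewrite (@esum_only _ _ 0) => [||k k0]; last 2 first.
    + by apply: esum_ge0 => m _; rewrite lee_fin !mulr_ge0.
    + by apply: esum1 => m _; rewrite (negbTE k0) mul0r.
    by under eq_esum do rewrite mul1r; rewrite esumZl_real ?hZ ?mulr_ge0.
  - have xy0 : 0 <= x1 * y1 by rewrite mulr_ge0.
    transitivity (\esum_(k in [set: int]) ((x1 * y1)%:E * \esum_(m in [set: int]) (zpow s k * zpow s m)%:E))%E.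
      apply: eq_esum => k _; rewrite esumZl_real// => m; exact: mulr_ge0.
    rewrite esumZl// ?(@esum_mul_real _ _ _ _ _ Z Z)//.
    by move=> k _; apply: esum_ge0 => m _; rewrite lee_fin mulr_ge0.
(* The mixed terms need only the factor 1, which is at most 2^(s+1). *)
apply: (@le_trans _ _ (x0 * y1 * Z + x1 * y0 * Z +
   (2 `^ s * (x1 * y1) * (Z * Z) + 2 `^ s * (x1 * y1) * (Z * Z)))%:E); last first.
  have -> : 2 `^ s * (x1 * y1) * (Z * Z) + 2 `^ s * (x1 * y1) * (Z * Z) =
      2 `^ (s + 1) * (x1 * y1 * (Z * Z)).
    rewrite powRD ?powRr1//; last by rewrite pnatr_eq0 implybT.
    by ring.
  rewrite -EFinM lee_fin [leRHS]mulrDr lerD2r ler_peMl//.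
  by rewrite addr_ge0// !mulr_ge0.
apply: (@le_trans _ _ (\esum_(k in [set: int]) \esum_(m in [set: int])
  ((k == 0)%:R * (x0 * y1 * (zpow s m * N m)) + (m == 0)%:R * (x1 * y0 * (zpow s k * N (- k)))
   + (2 `^ s * (x1 * y1) * (zpow s k * (zpow s (m - k) * N (m - k)))
     + 2 `^ s * (x1 * y1) * (zpow s m * (zpow s (m - k) * N (m - k)))))%:E)%E).
  apply: le_esum => k _; apply: le_esum => m _; rewrite lee_fin -/(N (m - k)).
  have [->|km] := eqVneq k m.
    by rewrite mul0r !addr_ge0// !mulr_ge0.
  rewrite mul1r /slice.
  case: (eqVneq k 0) => [k0|k0]; case: (eqVneq m 0) => [m0|m0] /=.
  - by rewrite k0 m0 eqxx in km.
  - by rewrite k0 subr0 mul1r mul0r addr0 !mulrA lerDl addr_ge0// !mulr_ge0.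
  - rewrite m0 sub0r mul1r mul0r add0r [leLHS](_ : _ = x1 * y0 * (zpow s k * N (- k))); last by ring.
    by rewrite lerDl addr_ge0// !mulr_ge0.
  rewrite !mul0r !add0r -mulrDr -mulrDl.
  rewrite [leLHS](_ : _ = x1 * y1 * N (m - k) * (zpow s k * zpow s m)); last by ring.
  apply: le_trans (ler_wpM2l _ (zpow_mul_le km)) _; first by rewrite !mulr_ge0.
  by rewrite le_eqVlt; apply/orP; left; apply/eqP; ring.
have c0 : 0 <= 2 `^ s * (x1 * y1) by rewrite !mulr_ge0.
rewrite esum2D; last 2 first.
- by move=> k m; rewrite addr_ge0// !mulr_ge0.
- by move=> k m; rewrite addr_ge0// !mulr_ge0.
rewrite esum2D; last 2 first.
- by move=> k m; rewrite !mulr_ge0.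
- by move=> k m; rewrite !mulr_ge0.
rewrite esum2D; last 2 first.
- by move=> k m; rewrite !mulr_ge0.
- by move=> k m; rewrite !mulr_ge0.
rewrite !EFinD; apply: leeD; apply: leeD.
- rewrite (@esum_only _ _ 0) => [||k k0]; last 2 first.
  + by apply: esum_ge0 => m _; rewrite lee_fin !mulr_ge0.
  + by apply: esum1 => m _; rewrite (negbTE k0) mul0r.
  under eq_esum do rewrite mul1r.
  rewrite esumZl_real ?mulr_ge0// => [|m]; last by rewrite mulr_ge0.
  by rewrite [leRHS]EFinM lee_wpmul2l// lee_fin mulr_ge0.
- rewrite esum_exchange; last by move=> k m _ _; rewrite lee_fin !mulr_ge0.
  rewrite (@esum_only _ _ 0) => [||k k0]; last 2 first.
  + by apply: esum_ge0 => m _; rewrite lee_fin !mulr_ge0.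
  + by apply: esum1 => m _; rewrite (negbTE k0) mul0r.
  under eq_esum do rewrite mul1r.
  rewrite esumZl_real ?mulr_ge0// => [|m]; last by rewrite mulr_ge0.
  rewrite [leRHS]EFinM lee_wpmul2l//; first by rewrite lee_fin mulr_ge0.
  rewrite (esum_reindex_bij (e := -%R)); last by exists -%R; exact: opprK.
  by under eq_esum do rewrite zpowN opprK.
(* For fixed [k] the substitution l = m - k makes the inner sum an average over [l], bounded by [Z]
   uniformly in [k]. The last summand is treated alike, with [m] fixed instead. *)
- have H (k : int) : (\esum_(m in [set: int])
      (2 `^ s * (x1 * y1) * (zpow s k * (zpow s (m - k) * N (m - k))))%:E
      <= (2 `^ s * (x1 * y1) * Z)%:E * (zpow s k)%:E)%E.
    rewrite (esum_reindex_bij (e := fun m => m + k)); last first.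
      by exists (fun m => m - k) => m; [exact: addrK|exact: subrK].
    under eq_esum do rewrite addrK mulrA.
    rewrite esumZl_real ?mulr_ge0// => [|m]; last by rewrite mulr_ge0.
    rewrite -[leRHS]EFinM [X in (_ <= X%:E)%E]mulrAC [leRHS]EFinM lee_wpmul2l// lee_fin mulr_ge0//.
  apply: le_trans; first by apply: le_esum => k _; exact: H.
  rewrite esumZl ?mulr_ge0// => [|k _]; last by rewrite lee_fin.
  by rewrite hZ -EFinM -[X in (X%:E <= _)%E]mulrA.
- rewrite esum_exchange; last by move=> k m _ _; rewrite lee_fin !mulr_ge0.
  have H (m : int) : (\esum_(k in [set: int])
      (2 `^ s * (x1 * y1) * (zpow s m * (zpow s (m - k) * N (m - k))))%:E
      <= (2 `^ s * (x1 * y1) * Z)%:E * (zpow s m)%:E)%E.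
    rewrite (esum_reindex_bij (e := fun k => m - k)); last first.
      by exists (fun k => m - k) => k; rewrite opprB addrC subrK.
    under eq_esum do rewrite opprB addrC subrK mulrA.
    rewrite esumZl_real ?mulr_ge0// => [|k]; last by rewrite mulr_ge0.
    rewrite -[leRHS]EFinM [X in (_ <= X%:E)%E]mulrAC [leRHS]EFinM lee_wpmul2l// lee_fin mulr_ge0//.
  apply: le_trans; first by apply: le_esum => m _; exact: H.
  rewrite esumZl ?mulr_ge0// => [|k _]; last by rewrite lee_fin.
  by rewrite hZ -EFinM -[X in (X%:E <= _)%E]mulrA.
Qed.

End lattice_average.

(** * The quantities T_i as sums over Z^d *)

Section weights.
Context {R : realType}.
Implicit Types (g : {fset nat} -> R) (s : R).

(** The reciprocal of [rfun], with weights and exponent left free: the lambda-powers, the weights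
    enlarged by the support size and the weights of [theta] are all instances. *)
Definition wt g s (d : nat) (p : Zvec d) : R :=
  g (supp p) * \prod_(j | p j != 0) zpow s (p j).

Lemma wt_ge0 g s d (p : Zvec d) : (forall u, 0 <= g u) -> 0 <= wt g s p.
Proof. by move=> g0; rewrite mulr_ge0// prodr_ge0// => j _; exact: zpow_ge0. Qed.

Lemma wt_gt0 g s d (p : Zvec d) : (forall u, 0 < g u) -> 0 < wt g s p.
Proof. by move=> g0; rewrite mulr_gt0// prodr_gt0// => j pj; exact: zpow_gt0. Qed.

Lemma rprime_inv s d (p : Zvec d) :
  (rprime s p)^-1 = \prod_(j | p j != 0) zpow s (p j).
Proof. by rewrite /rprime -prodfV; apply: eq_bigr => j _; rewrite /zpow powRN. Qed.

Lemma rfun_inv g s d (p : Zvec d) : (rfun s g p)^-1 = wt g s p.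
Proof. by rewrite /rfun invfM invrK rprime_inv. Qed.

Lemma powR_prod (I : finType) (P : pred I) (F : I -> R) (l : R) :
  (forall i, 0 <= F i) -> (\prod_(i | P i) F i) `^ l = \prod_(i | P i) F i `^ l.
Proof.
move=> F0.
suff [] : 0 <= \prod_(i | P i) F i /\ (\prod_(i | P i) F i) `^ l = \prod_(i | P i) F i `^ l by [].
apply: (big_ind2 (fun x y => 0 <= x /\ x `^ l = y)).
- by rewrite powR1.
- by move=> x1 x2 y1 y2 [x0 <-] [y0 <-]; rewrite mulr_ge0// powRM.
- by move=> i _.
Qed.

Lemma wt_powR g s l d (p : Zvec d) : (forall u, 0 <= g u) ->
  (wt g s p) `^ l = wt (fun u => g u `^ l) (s * l) p.
Proof.
move=> g0; rewrite /wt powRM//; last by rewrite prodr_ge0// => j _; exact: zpow_ge0.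
rewrite powR_prod; last by move=> j; exact: zpow_ge0.
by congr (_ * _); apply: eq_bigr => j _; rewrite /zpow -powRrM mulNr.
Qed.

Lemma esum_wt g s d : (forall u, 0 <= g u) -> 1 < s ->
  (\esum_(p in [set: Zvec d]) (wt g s p)%:E =
   (\sum_(u : {set 'I_d}) g (fvals u) * (2 * zeta s) ^+ #|u|)%:E)%E.
Proof.
move=> g0 s1.
have s0 : s != 0 by rewrite gt_eqF// (lt_trans _ s1).
rewrite (esum_partition_fin (@zsupp d)) => [|p _]; last by rewrite lee_fin wt_ge0.
rewrite -sumEFin; apply: eq_bigr => u _.
rewrite setTI EFinM -(esum_zsupp_prod (v := zpow s) u)//.
- rewrite -esumZl// => [|p _]; last first.
    by rewrite lee_fin prodr_ge0// => j _; exact: zpow_ge0.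
  by apply: eq_esum => p /= pu; rewrite -EFinM /wt supp_fvals pu.
- by move=> k; exact: zpow_ge0.
- exact: zpow0.
- exact: esum_int_zeta.
Qed.

Lemma card_fvals d (u : {set 'I_d}) : #|` fvals u| = #|u|.
Proof.
by rewrite card_imfset /= -?cardE//; exact: val_inj.
Qed.

End weights.

(** * Splitting Z^d at a coordinate *)

Section embedding.
Context {R : realType} (d : nat) (i : 'I_d).

Let widen (k : 'I_i.+1) : 'I_d := widen_ord (ltn_ord i) k.

Let widen_le k : (widen k <= i)%N. Proof. exact: (ltn_ord k). Qed.

Definition zemb (h : Zvec i.+1) : Zvec d :=
  [ffun j : 'I_d => if insub (val j) is Some k then h (k : 'I_i.+1) else 0%:Z].

Definition zhigh : set (Zvec d) := [set t | forall j : 'I_d, (j <= i)%N -> t j = 0].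

Lemma zemb_widen h k : zemb h (widen k) = h k.
Proof.
rewrite ffunE /=; case: insubP => [k' _ e|]; last by rewrite ltn_ord.
by congr (h _); apply/val_inj.
Qed.

Lemma zemb_high h (j : 'I_d) : (i < j)%N -> zemb h j = 0.
Proof. by move=> ij; rewrite ffunE insubF//; apply/negbTE; rewrite -leqNgt. Qed.

Variant ord_split_spec (j : 'I_d) : Prop :=
| OrdLow k of j = widen k
| OrdHigh of (i < j)%N.

Lemma ord_splitP j : ord_split_spec j.
Proof.
have [ij|ij] := ltnP i j; first exact: OrdHigh.
by apply: (@OrdLow j (@Ordinal i.+1 j ij)); apply/val_inj.
Qed.

Lemma big_widen (T : Type) (idx : T) (op : Monoid.com_law idx) (F : 'I_d -> T) :
  (forall j : 'I_d, (i < j)%N -> F j = idx) ->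
  \big[op/idx]_(j < d) F j = \big[op/idx]_(k < i.+1) F (widen k).
Proof.
move=> Fi; rewrite -(big_ord_narrow (ltn_ord i)) [RHS]big_mkcond.
by apply: eq_bigr => j _; case: ltnP => // /Fi.
Qed.

Lemma zemb_inj : injective zemb.
Proof. by move=> h h' e; apply/ffunP => k; rewrite -!zemb_widen e. Qed.

Lemma Zadd_glue h t l : Zadd (Zadd (zemb h) t) (zemb l) = Zadd (zemb (Zadd h l)) t.
Proof.
apply/ffunP => j; rewrite !ffunE.
by case: insubP => [k _ _|_]; rewrite ?ffunE ?addr0// addrAC.
Qed.

Lemma glueE h t j : zhigh t ->
  Zadd (zemb h) t j = (zemb h j) + t j /\ ((zemb h j = 0) \/ t j = 0).
Proof.
move=> th; split; first by rewrite ffunE.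
case: (ord_splitP j) => [k ->|ij]; last by left; rewrite zemb_high.
by right; apply: th; exact: widen_le.
Qed.

Lemma supp_glue h t : zhigh t -> supp (Zadd (zemb h) t) = (supp h `|` fvals (zsupp t))%fset.
Proof.
move=> th; rewrite !supp_fvals; apply/fsetP => x; rewrite in_fsetU; apply/idP/orP.
  move=> /imfsetP[j /= jp ->]; move: jp; rewrite in_zsupp ffunE.
  case: (ord_splitP j) => [k ->|ij].
    rewrite zemb_widen th ?addr0; last exact: widen_le.
    by move=> hk; left; apply/imfsetP; exists k => //=; rewrite in_zsupp.
  rewrite zemb_high// add0r => tj; right; apply/imfsetP; exists j => //=.
  by rewrite in_zsupp.
case=> /imfsetP[j /= jp ->]; apply/imfsetP.
  exists (widen j) => //=; rewrite in_zsupp ffunE zemb_widen th ?addr0 -?in_zsupp//.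
exists j => //=; move: jp; rewrite !in_zsupp ffunE => tj.
case: (ord_splitP j) => [k e|ij]; last by rewrite zemb_high// add0r.
by move: tj; rewrite th ?eqxx// e widen_le.
Qed.

Lemma prod_glue (s : R) h t : zhigh t ->
  \prod_(j | Zadd (zemb h) t j != 0) zpow s (Zadd (zemb h) t j) =
  (\prod_(k | h k != 0) zpow s (h k)) * \prod_(j | t j != 0) zpow s (t j).
Proof.
move=> th; rewrite big_mkcond [X in X * _]big_mkcond [X in _ * X]big_mkcond.
pose zp k : R := if k != 0 then zpow s k else 1.
have -> : \prod_k (if h k != 0 then zpow s (h k) else 1) = \prod_(j < d) zp (zemb h j).
  rewrite (@big_widen _ 1 *%R (fun j => zp (zemb h j))) => [|j ij]; last by rewrite zemb_high// /zp eqxx.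
  by apply: eq_bigr => k _; rewrite zemb_widen.
rewrite -big_split /=; apply: eq_bigr => j _.
have [-> [] ->] := glueE h j th; rewrite ?add0r ?addr0 /zp ?eqxx ?mul1r ?mulr1//.
Qed.

Lemma dual_emb n (zt : 'I_d -> nat) (zs : 'I_i.+1 -> nat) l :
  (forall k, zs k = zt (widen k)) -> dual_cond n zt (zemb l) = dual_cond n zs l.
Proof.
move=> zz; rewrite /dual_cond (@big_widen _ 0 +%R (fun j => zemb l j * (zt j)%:Z)).
  by congr (_ \in dvdz _); apply: eq_bigr => k _; rewrite zemb_widen zz.
by move=> j ij; rewrite zemb_high// mul0r.
Qed.

Definition last_nonzero (l : Zvec d) : bool :=
  (l i != 0) && [forall j : 'I_d, (i < j)%N ==> (l j == 0)].

(** In dimension [i.+1] only the condition on the last coordinate remains of [last_nonzero]; the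
    vanishing of the later coordinates is built into [zemb]. *)
Lemma last_nonzero_emb n (zt : 'I_d -> nat) (zs : 'I_i.+1 -> nat) :
  (forall k, zs k = zt (widen k)) ->
  set_bij [set l : Zvec i.+1 |
      (exists j : 'I_i.+1, (val j).+1 = i.+1 /\ l j != 0) /\ dual_cond n zs l]
    [set l | last_nonzero l && dual_cond n zt l] zemb.
Proof.
move=> zz; split.
- move=> l /= [[j [[ji] lj]] dl]; rewrite (dual_emb _ _ zz) dl andbT.
  apply/andP; split; last first.
    by apply/forallP => k; apply/implyP => ik; rewrite zemb_high.
  by rewrite (_ : i = widen j) ?zemb_widen//; apply/val_inj.
- by move=> l l' _ _ /zemb_inj.
- move=> l /= /andP[/andP[li /forallP lh] dl].
  have el : zemb [ffun k => l (widen k)] = l.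
    apply/ffunP => j; case: (ord_splitP j) => [k ->|ij]; first by rewrite zemb_widen ffunE.
    by rewrite zemb_high//; apply/esym/eqP; exact: (implyP (lh j)).
  exists [ffun k => l (widen k)] => //=; split; last by rewrite -(dual_emb _ _ zz) el.
  exists ord_max; split => //; rewrite ffunE (_ : widen _ = i)//.
  exact/val_inj.
Qed.

Lemma glue_bij : set_bij ([set: Zvec i.+1] `*`` fun=> zhigh) [set: Zvec d]
  (fun ht => Zadd (zemb ht.1) ht.2).
Proof.
have low h t k : zhigh t -> Zadd (zemb h) t (widen k) = h k.
  by move=> th; rewrite ffunE zemb_widen th ?addr0// widen_le.
have high h t (j : 'I_d) : (i < j)%N -> Zadd (zemb h) t j = t j.
  by move=> ij; rewrite ffunE zemb_high// add0r.
split=> //.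
  move=> [h t] [h' t'] /set_mem[_ /= th] /set_mem[_ /= th'] e; congr pair.
    by apply/ffunP => k; rewrite -(low h t)// e low.
  apply/ffunP => j; have [ij|ij] := ltnP i j; first by rewrite -(high h) // e high.
  by rewrite th// th'.
move=> p _; exists ([ffun k => p (widen k)], [ffun j : 'I_d => if (i < j)%N then p j else 0]).
  by split => //= j ji; rewrite ffunE ltnNge ji.
apply/ffunP => j; rewrite ffunE /=; case: (ord_splitP j) => [k ->|ij].
  by rewrite zemb_widen !ffunE ltnNge widen_le addr0.
by rewrite zemb_high// ffunE ij add0r.
Qed.

End embedding.

Section cbc_identity.
Context {R : realType} (n d : nat) (alpha : R) (gamma : {fset nat} -> R).
Hypotheses (a1 : 1 < alpha) (g0 : forall u, 0 < gamma u).

Let g0' u : 0 <= gamma u. Proof. exact: ltW. Qed.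

(** The quantity minimized at step [i], written over Z^d so that all steps share one index set and
    can be added. The conditions on [l] are 0/1 factors, so that they can be summed over the units
    under the sums over [p] and [l]. *)
Definition Tfull (i : 'I_d) (z : 'I_d -> nat) : \bar R :=
  (\esum_(p in [set: Zvec d]) \esum_(l in [set: Zvec d])
     ((last_nonzero i l && dual_cond n z l)%:R *
       (wt gamma alpha p * wt gamma alpha (Zadd p l)))%:E)%E.

(* Write [p] as a vector [h] on the coordinates up to [i] glued with a vector [t]
   on the later ones: [l] leaves [t] fixed, so [t] enters squared, and the sum over
   all [t] of support [w] is [(2 * zeta (2 * alpha)) ^+ #|w|]. *)
Lemma Tcbc_full (i : 'I_d) (zt : 'I_d -> nat) (zs : 'I_i.+1 -> nat) :
  (forall k, zs k = zt (widen_ord (ltn_ord i) k)) ->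
  Tcbc n d alpha gamma zs = Tfull i zt.
Proof.
move=> zz.
pose LL := [set l : Zvec i.+1 |
      (exists j : 'I_i.+1, (val j).+1 = i.+1 /\ l j != 0) /\ dual_cond n zs l].
pose beta (w : {set 'I_d}) (u : {fset nat}) := gamma (u `|` fvals w)%fset.
pose G w (h l : Zvec i.+1) := wt (beta w) alpha h * wt (beta w) alpha (Zadd h l).
pose P (t : Zvec d) : R := \prod_(j | t j != 0) zpow (2 * alpha) (t j).
have P0 t : 0 <= P t by rewrite prodr_ge0// => j _; exact: zpow_ge0.
have G0 w h l : 0 <= G w h l by rewrite mulr_ge0// wt_ge0// => u; exact: g0'.
have b0 (p : Zvec d) : 0 <= wt gamma alpha p by rewrite wt_ge0.
have a2 : 1 < 2 * alpha by have := a1; lra.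
set Z2 := 2 * zeta (2 * alpha).
have Z20 : 0 <= Z2 by rewrite mulr_ge0// zeta_ge0.
have hP (w : {set 'I_d}) : (\esum_(t in [set t | zsupp t = w]) (P t)%:E = (Z2 ^+ #|w|)%:E)%E.
  apply: esum_zsupp_prod; first by move=> k; exact: zpow_ge0.
  - by apply: zpow0; rewrite gt_eqF// (lt_trans _ a2).
  - exact: esum_int_zeta.
transitivity (\esum_(h in [set: Zvec i.+1]) \esum_(t in zhigh i) \esum_(l in LL)
    (G (zsupp t) h l * P t)%:E)%E; last first.
  apply/esym; rewrite /Tfull.
  transitivity (\esum_(p in [set: Zvec d]) \esum_(l in LL)
       (wt gamma alpha p * wt gamma alpha (Zadd p (zemb l)))%:E)%E.
    apply: eq_esum => p _.
    rewrite -(@esum_indicator _ _ [set l | last_nonzero i l && dual_cond n zt l])//.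
    by rewrite (@reindex_esum _ _ _ _ _ _ _ (last_nonzero_emb n zz)).
  rewrite (@reindex_esum _ _ _ _ _ _ _ (glue_bij i)).
  rewrite -(@esum_esum _ _ _ [set: Zvec i.+1] (fun=> zhigh i) (fun h t =>
    \esum_(l in LL) (wt gamma alpha (Zadd (zemb h) t) *
        wt gamma alpha (Zadd (Zadd (zemb h) t) (zemb l)))%:E)); last first.
    by move=> h t _ _; apply: esum_ge0 => l _; rewrite lee_fin mulr_ge0.
  apply: eq_esum => h _; apply: eq_esum => t th; apply: eq_esum => l _; congr (_%:E).
  rewrite Zadd_glue /wt !supp_glue// !prod_glue//.
  have -> : P t = (\prod_(j | t j != 0) zpow alpha (t j)) * (\prod_(j | t j != 0) zpow alpha (t j)).
    rewrite -big_split /=; apply: eq_bigr => j tj.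
    rewrite /zpow -powRD; last by rewrite pnatr_eq0 absz_eq0 tj implybT.
    by congr (_ `^ _); ring.
  by rewrite /G /wt /beta; ring.
(* The vectors [t] are grouped by their support [w]; a [w] meeting the coordinates up to [i]
   supports no admissible [t]. *)
transitivity (\esum_(h in [set: Zvec i.+1]) \sum_(w : {set 'I_d} | [forall j in w, (i.+1 <= val j)%N])
    ((Z2 ^+ #|w|)%:E * \esum_(l in LL) (G w h l)%:E))%E.
  rewrite esum_sum; last first.
    move=> h w _ _; apply: mule_ge0; first by rewrite lee_fin exprn_ge0.
    by apply: esum_ge0 => l _; rewrite lee_fin.
  apply: eq_bigr => w _; rewrite [RHS]esumZl ?exprn_ge0//; last first.
    by move=> h _; apply: esum_ge0 => l _; rewrite lee_fin.
  congr (_ * _)%E; apply: eq_esum => h _; apply: eq_esum => l _.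
  by rewrite !rprime_inv.
apply: eq_esum => h _.
rewrite (esum_partition_fin (@zsupp d)); last first.
  by move=> t _; apply: esum_ge0 => l _; rewrite lee_fin mulr_ge0.
rewrite big_mkcond /=; apply: eq_bigr => w _.
case: ifPn => [/forallP hw|hw].
  have -> : zhigh i `&` [set x | zsupp x = w] = [set t | zsupp t = w].
    apply/seteqP; split=> [t []//|t /= tw]; split => // j ji.
    apply/eqP/negPn/negP; rewrite -in_zsupp tw => jw.
    by have := implyP (hw j) jw; rewrite ltnNge ji.
  rewrite (eq_esum (b := fun t => \esum_(l in LL) (G w h l * P t)%:E)%E); last first.
    by move=> t /= ->.
  rewrite esum_exchange; last by move=> *; rewrite lee_fin mulr_ge0.
  rewrite -esumZl ?exprn_ge0//; last by move=> l _; rewrite lee_fin.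
  apply: eq_esum => l _; under [RHS]eq_esum do rewrite EFinM.
  rewrite esumZl//; last by move=> t _; rewrite lee_fin.
  by rewrite hP muleC.
have -> : zhigh i `&` [set x | zsupp x = w] = set0; last by rewrite esum_set0.
apply/seteqP; split=> // t [th /= tw]; move: hw; rewrite negb_forall => /existsP[j].
rewrite negb_imply -leqNgt => /andP[jw ji].
by move: jw; rewrite -tw in_zsupp th ?eqxx.
Qed.

(** A nonzero [l] has a largest index with nonzero coordinate; there [last_nonzero] holds, so the
    indicators over [i] add up to at least 1. *)
Lemma Ssum_le_Tfull (z : 'I_d -> nat) :
  (Ssum n alpha gamma z <= \sum_(i < d) Tfull i z)%E.
Proof.
have b0 (p : Zvec d) : 0 <= wt gamma alpha p by rewrite wt_ge0.
have bb0 (p q : Zvec d) : 0 <= wt gamma alpha p * wt gamma alpha q by exact: mulr_ge0.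
rewrite /Ssum /Tfull -esum_sum; last first.
  by move=> p i _ _; apply: esum_ge0 => l _; rewrite lee_fin mulr_ge0.
apply: le_esum => p _.
rewrite -esum_sum; last by move=> l i _ _; rewrite lee_fin mulr_ge0.
rewrite (@esum_indicator _ _ _ (fun l => (l != Zzero d) && dual_cond n z l)); last first.
  by move=> l /=; split => [[-> ->]//|/andP[]].
rewrite -esumZl; last 2 first.
- by rewrite rfun_inv.
- by move=> l _; rewrite lee_fin mulr_ge0// rfun_inv.
apply: le_esum => l _; rewrite -EFinM !rfun_inv sumEFin lee_fin -mulr_suml mulrCA.
rewrite ler_wpM2r//.
have [l0|l0] := eqVneq l (Zzero d); first by rewrite sumr_ge0.
have [j0 lj0] : exists j, l j != 0.
  apply/existsP; rewrite -negb_forall; apply: contra l0 => /forallP H.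
  by apply/eqP/ffunP => j; rewrite ffunE; apply/eqP; exact: H.
case: (@arg_maxnP _ j0 (fun j => l j != 0) val lj0) => i li imax.
rewrite (bigD1 i)//= /last_nonzero li /=.
have -> : [forall j : 'I_d, (i < j)%N ==> (l j == 0)].
  apply/forallP => j; apply/implyP; apply: contraTT => lj.
  by rewrite -leqNgt; exact: imax.
by rewrite /= lerDl sumr_ge0.
Qed.

End cbc_identity.

(** * Averaging over the units *)

Section averaging.
Context {R : realType} (n d : nat).

Lemma esum_pair (T U : choiceType) (f : T -> U -> R) : (forall x y, 0 <= f x y) ->
  (\esum_(x in [set: T]) \esum_(y in [set: U]) (f x y)%:E =
   \esum_(k in [set: T * U]) (f k.1 k.2)%:E)%E.
Proof.
move=> f0; rewrite (@esum_esum _ _ _ _ (fun=> [set: U]) (fun x y => (f x y)%:E)) => [|x y _ _]; last first.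
  by rewrite lee_fin.
by congr esum; apply/seteqP; split.
Qed.

Lemma Zadd_bij (p : Zvec d) : bijective (Zadd p).
Proof.
exists (fun q : Zvec d => [ffun j => q j - p j] : Zvec d) => q;
  apply/ffunP => j; rewrite !ffunE; first by rewrite addrC addKr.
by rewrite addrC subrK.
Qed.

Lemma esum2_slice (i : 'I_d) (F : Zvec d -> Zvec d -> R) : (forall p q, 0 <= F p q) ->
  (\esum_(p in [set: Zvec d]) \esum_(q in [set: Zvec d]) (F p q)%:E =
   \esum_(p in [set p : Zvec d | p i = 0%R]) \esum_(q in [set q : Zvec d | q i = 0%R])
    \esum_(k in [set: int]) \esum_(m in [set: int]) (F (zupd p i k) (zupd q i m))%:E)%E.
Proof.
move=> F0.
have F1 p : (0 <= \esum_(q in [set: Zvec d]) (F p q)%:E)%E.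
  by apply: esum_ge0 => q _; rewrite lee_fin.
rewrite (esum_slice i)//; apply: eq_esum => p _.
rewrite [RHS]esum_exchange; last first.
  by move=> q k _ _; apply: esum_ge0 => m _; rewrite lee_fin.
apply: eq_esum => k _; rewrite (esum_slice i)// => q.
by rewrite lee_fin.
Qed.

(** All nonzero values of the [i]-th coordinate give the same support, hence the same factor [g];
    the value 1 serves as reference. *)
Lemma wt_zupd (g : {fset nat} -> R) (s : R) (p : Zvec d) (i : 'I_d) (k : int) : p i = 0 ->
  wt g s (zupd p i k) = slice s (wt g s p) (wt g s (zupd p i 1)) k.
Proof.
move=> p0; rewrite /slice; case: eqVneq => [->|k0].
  by rewrite -p0 zupd_same.
rewrite /wt !supp_fvals -mulrA; congr (_ * _).
  congr (g (fvals _)); apply/setP => j; rewrite !in_zsupp !zupdE.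
  by case: (eqVneq j i); rewrite ?k0.
rewrite (bigD1 i) ?zupd_id//= [in RHS](bigD1 i) ?zupd_id//=.
rewrite [X in X * _ * _](_ : _ = 1); last by rewrite /zpow powR1.
rewrite mul1r mulrC; congr (_ * _).
by apply: eq_big => j; rewrite !zupdE; case: (eqVneq j i); rewrite ?andbF.
Qed.

Lemma totient_sum : (2 <= n)%N -> totient n = (\sum_(c < n | inU n c) 1)%N.
Proof.
move=> n2; rewrite totient_count_coprime big_mkord [RHS]big_mkcond.
apply: eq_bigr => c _; rewrite /inU ltn_ord andbT coprime_sym.
case: (posnP c) => [->|_] /=; last by case: coprime.
by rewrite /coprime gcd0n; case: n n2 => [|[]].
Qed.

(** Since [A] ignores coordinate [i], it is constant on each pair of lines in that direction, and
    the bound for two integer variables applies there. *)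
Lemma esum_nsol_slice_le (s : R) (g : {fset nat} -> R) (i : 'I_d)
    (A : Zvec d -> Zvec d -> int) : (0 < n)%N -> 1 < s -> (forall u, 0 <= g u) ->
  (forall p q k m, A (zupd p i k) (zupd q i m) = A p q) ->
  (\esum_(p in [set: Zvec d]) \esum_(q in [set: Zvec d])
     ((p i != q i)%:R * (wt g s p * wt g s q * (nsol n (q i - p i) (A p q))%:R))%:E <=
   (2 `^ (s + 1))%:E * \esum_(p in [set: Zvec d]) \esum_(q in [set: Zvec d])
     (((p i != 0%R) || (q i != 0%R))%:R * (wt g s p * wt g s q))%:E)%E.
Proof.
move=> n0 s1 g0 hA.
have b0 (p : Zvec d) : 0 <= wt g s p by exact: wt_ge0.
have bb0 (p q : Zvec d) : 0 <= wt g s p * wt g s q by exact: mulr_ge0.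
rewrite (@esum2_slice i (fun p q =>
  (p i != q i)%:R * (wt g s p * wt g s q * (nsol n (q i - p i) (A p q))%:R))); last first.
  by move=> p q; rewrite mulr_ge0// mulr_ge0.
rewrite (@esum2_slice i (fun p q =>
  ((p i != 0%R) || (q i != 0%R))%:R * (wt g s p * wt g s q))); last first.
  by move=> p q; rewrite mulr_ge0.
have c0 : 0 <= 2 `^ (s + 1) :> R by exact: powR_ge0.

rewrite -esumZl//; last first.
  move=> p _; apply: esum_ge0 => q _; apply: esum_ge0 => k _; apply: esum_ge0 => m _.
  by rewrite lee_fin mulr_ge0.
apply: le_esum => p /= p0; rewrite -esumZl//; last first.
  move=> q _; apply: esum_ge0 => k _; apply: esum_ge0 => m _.
  by rewrite lee_fin mulr_ge0.
apply: le_esum => q /= q0.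
rewrite (eq_esum (b := fun k => \esum_(m in [set: int]) ((k != m)%:R *
  (slice s (wt g s p) (wt g s (zupd p i 1)) k * slice s (wt g s q) (wt g s (zupd q i 1)) m *
    (nsol n (m - k) (A p q))%:R))%:E)%E); last first.
  move=> k _; apply: eq_esum => m _.
  by rewrite !zupd_id hA (wt_zupd _ _ k p0) (wt_zupd _ _ m q0).
rewrite [X in (_ <= _ * X)%E](eq_esum (b := fun k => \esum_(m in [set: int])
  (((k != 0%R) || (m != 0%R))%:R *
  (slice s (wt g s p) (wt g s (zupd p i 1)) k * slice s (wt g s q) (wt g s (zupd q i 1)) m))%:E)%E);
    last first.
  move=> k _; apply: eq_esum => m _.
  by rewrite !zupd_id (wt_zupd _ _ k p0) (wt_zupd _ _ m q0).
exact: slice_sum_nsol_le.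
Qed.

End averaging.

(** * The bound on S for a CBC vector *)

Section cbc_bound.
Context {R : realType} (n d : nat) (alpha lambda : R) (gamma : {fset nat} -> R).
Context (z : 'I_d -> nat).
Hypotheses (n2 : (2 <= n)%N) (a1 : 1 < alpha) (g0 : forall u, 0 < gamma u).
Hypotheses (al : 1 < alpha * lambda) (l01 : 0 < lambda <= 1).
Hypothesis cbc : is_CBC n alpha gamma z.

Let n0 : (0 < n)%N. Proof. exact: leq_trans n2. Qed.
Let g0' u : 0 <= gamma u. Proof. exact: ltW. Qed.
Let B (p : Zvec d) : R := wt (fun u => gamma u `^ lambda) (alpha * lambda) p.
Let B0 p : 0 <= B p. Proof. by apply: wt_ge0 => u; exact: powR_ge0. Qed.
Let BB0 p q : 0 <= B p * B q. Proof. exact: mulr_ge0. Qed.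

Lemma powR_indicator (b : bool) (x l : R) : 0 < l -> 0 <= x -> (b%:R * x) `^ l = b%:R * x `^ l.
Proof. by move=> l0 x0; case: b; rewrite ?mul1r// !mul0r powR0// gt_eqF. Qed.

Lemma Tfull_poweR_le (i : 'I_d) (zt : 'I_d -> nat) :
  (poweR (Tfull n alpha gamma i zt) lambda <=
   \esum_(p in [set: Zvec d]) \esum_(l in [set: Zvec d])
     ((last_nonzero i l && dual_cond n zt l)%:R * (B p * B (Zadd p l)))%:E)%E.
Proof.
have /andP[l0 _] := l01.
have b0 (p : Zvec d) : 0 <= wt gamma alpha p by exact: wt_ge0.
have bb0 (p q : Zvec d) : 0 <= wt gamma alpha p * wt gamma alpha q by exact: mulr_ge0.
rewrite /Tfull esum_pair; last by move=> p l; rewrite mulr_ge0.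
rewrite esum_pair; last by move=> p l; rewrite mulr_ge0.
apply: le_trans (poweR_esum_le l01 _) _; first by move=> k; rewrite mulr_ge0.
apply: le_esum => -[p l] _ /=; rewrite lee_fin powR_indicator// powRM//.
by rewrite !wt_powR.
Qed.

Lemma cbc_average (i : 'I_d) :
  ((totient n)%:R%:E * poweR (Tfull n alpha gamma i z) lambda <=
   (2 `^ (alpha * lambda + 1))%:E * \esum_(p in [set: Zvec d]) \esum_(q in [set: Zvec d])
     (((p i != 0%R) || (q i != 0%R))%:R * (B p * B q))%:E)%E.
Proof.
have /andP[l0 _] := l01.
pose zc c (j : 'I_d) : nat := if j == i then c else z j.
have T0 zt : (0 <= Tfull n alpha gamma i zt)%E.
  apply: esum_ge0 => p _; apply: esum_ge0 => l _.
  by rewrite lee_fin mulr_ge0// mulr_ge0// wt_ge0.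
(* Both [zrep z i c] and [zc c] have the same coordinates up to [i], and these determine [Tfull] at
   [i]. *)
have Tc c : inU n c -> (Tfull n alpha gamma i z <= Tfull n alpha gamma i (zc c))%E.
  move=> /(cbc i).2.
  rewrite (@Tcbc_full _ _ _ _ _ a1 g0 i z (zpre z i))//.
  rewrite (@Tcbc_full _ _ _ _ _ a1 g0 i (zc c) (zrep z i c))//.
have -> : (totient n)%:R%:E = (\sum_(c < n | inU n c) (1%R%:E : \bar R))%E.
  by rewrite sumEFin totient_sum// natr_sum.
rewrite ge0_sume_distrl//.
apply: (@le_trans _ _ (\sum_(c < n | inU n c) \esum_(p in [set: Zvec d]) \esum_(l in [set: Zvec d])
     ((last_nonzero i l && dual_cond n (zc c) l)%:R * (B p * B (Zadd p l)))%:E)%E).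
  apply: lee_sum => c cU; rewrite mul1e.
  apply: le_trans (Tfull_poweR_le i (zc c)).
  by apply: gt0_ler_poweR; rewrite ?(ltW l0) ?in_itv /= ?T0 ?leey// Tc.
(* The share of the coordinates other than [i] in the dual condition for l = q - p: for the vector
   [zc c] that condition reads n | l_i c + A p q. *)
pose A (p q : Zvec d) : int := \sum_(j | j != i) (q j - p j) * (z j)%:Z.
rewrite -esum_sum; last first.
  by move=> p c _ _; apply: esum_ge0 => l _; rewrite lee_fin mulr_ge0.
apply: le_trans (@esum_nsol_slice_le R n d (alpha * lambda) _ i A n0 al _ _); last 2 first.
- by move=> u; exact: powR_ge0.
- by move=> p q k m; apply: eq_bigr => j ji; rewrite !zupdE (negbTE ji).
apply: le_esum => p _.
rewrite -esum_sum; last by move=> l c _ _; rewrite lee_fin mulr_ge0.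
rewrite [leRHS](esum_reindex_bij _ (Zadd_bij p)).
apply: le_esum => l _; rewrite sumEFin lee_fin -mulr_suml -/(B p) -/(B (Zadd p l)).
have ei : Zadd p l i - p i = l i by rewrite ffunE addrC addKr.
rewrite ei.
have [li|li] := boolP (last_nonzero i l); last first.
  by rewrite big1 ?mul0r// mulr_ge0// mulr_ge0.
(* Of [last_nonzero] only l_i != 0 is retained, that is, p_i != q_i. *)
have -> : (p i != Zadd p l i) = true.
  by rewrite eq_sym -subr_eq0 ei; case/andP: li.
rewrite mul1r mulrC ler_wpM2l// /nsol natr_sum.
apply: ler_sum => c _; rewrite andTb /dual_cond (bigD1 i)//= {1}/zc eqxx.
rewrite (_ : \sum_(j | j != i) l j * (zc c j)%:Z = A p (Zadd p l))//.
by apply: eq_bigr => j ji; rewrite /zc (negbTE ji) ffunE addrC addKr.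
Qed.

(** Bounding the sum of the two support sizes by twice a product lets the double sum over [p] and
    [q] factor; this is where the [maxn _ 1] in [wsum] comes from. *)
Lemma sum_indicator_le (p q : Zvec d) :
  (\sum_(i < d) ((p i != 0) || (q i != 0)) <=
   2 * (maxn #|zsupp p| 1 * maxn #|zsupp q| 1))%N.
Proof.
apply: (@leq_trans (#|zsupp p| + #|zsupp q|)); last by nia.
rewrite -!sum1_card [X in (_ <= X + _)%N]big_mkcond [X in (_ <= _ + X)%N]big_mkcond -big_split /=.
by apply: leq_sum => i _; rewrite !in_zsupp; case: (p i != 0); case: (q i != 0).
Qed.

Lemma wsum_ge0 : 0 <= wsum alpha gamma d lambda.
Proof.
apply: sumr_ge0 => u _; rewrite mulr_ge0//; first by rewrite mulr_ge0// powR_ge0.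
by rewrite exprn_ge0// mulr_ge0// zeta_ge0.
Qed.

Lemma Ssum_ge0 : (0 <= Ssum n alpha gamma z)%E.
Proof.
have r0 (p : Zvec d) : (0 <= ((rfun alpha gamma p)^-1)%:E)%E by rewrite lee_fin rfun_inv wt_ge0.
by apply: esum_ge0 => p _; apply: mule_ge0 => //; apply: esum_ge0 => l _.
Qed.

Lemma cbc_Ssum_bound :
  ((totient n)%:R%:E * poweR (Ssum n alpha gamma z) lambda <=
   ((2 `^ (2 * alpha * lambda + 1) + 1) * wsum alpha gamma d lambda ^+ 2)%:E)%E.
Proof.
have /andP[l0 _] := l01.
set W := wsum _ _ _ _; have W0 : 0 <= W by exact: wsum_ge0.
have T0 i : (0 <= Tfull n alpha gamma i z)%E.
  apply: esum_ge0 => p _; apply: esum_ge0 => l _.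
  by rewrite lee_fin mulr_ge0// mulr_ge0// wt_ge0.
have c0 : 0 <= 2 `^ (alpha * lambda + 1) :> R by exact: powR_ge0.
apply: (@le_trans _ _ ((totient n)%:R%:E * \sum_(i < d) poweR (Tfull n alpha gamma i z) lambda)%E).
  apply: lee_wpmul2l => //; apply: le_trans (poweR_le_sum _ l01 _) => //.
  apply: gt0_ler_poweR; rewrite ?(ltW l0) ?in_itv /= ?leey ?andbT//.
  - exact: Ssum_ge0.
  - exact: sume_ge0.
  - exact: Ssum_le_Tfull.
rewrite ge0_sume_distrr => [|i _]; last exact: poweR_ge0.
apply: le_trans; first by apply: lee_sum => i _; exact: cbc_average.
rewrite -ge0_sume_distrr => [|i _]; last first.
  by apply: esum_ge0 => p _; apply: esum_ge0 => q _; rewrite lee_fin mulr_ge0.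
rewrite -esum_sum; last first.
  by move=> p i _ _; apply: esum_ge0 => q _; rewrite lee_fin mulr_ge0.
(* The size factor is absorbed into the weights, so that the sum over Z^d of the new weights is
   exactly [wsum]. *)
pose g (u : {fset nat}) : R := (maxn #|` u| 1)%:R * gamma u `^ lambda.
have g1 u : 0 <= g u by rewrite mulr_ge0// powR_ge0.
have wg (p : Zvec d) : wt g (alpha * lambda) p = (maxn #|zsupp p| 1)%:R * B p.
  by rewrite /wt /g supp_fvals card_fvals -mulrA /B /wt supp_fvals.
have EW : (\esum_(p in [set: Zvec d]) (wt g (alpha * lambda) p)%:E = W%:E)%E.
  by rewrite esum_wt//; congr (_%:E); apply: eq_bigr => u _; rewrite /g card_fvals.
apply: (@le_trans _ _ ((2 `^ (alpha * lambda + 1))%:E * (2 * (W * W))%:E)%E).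
  apply: lee_wpmul2l => //.
  rewrite EFinM -(esum_mul_real _ _ EW EW); last 2 first.
  - by move=> p; rewrite wt_ge0.
  - by move=> p; rewrite wt_ge0.
  rewrite -esumZl//; last first.
    by move=> p _; apply: esum_ge0 => q _; rewrite lee_fin mulr_ge0// wt_ge0.
  apply: le_esum => p _.
  rewrite -esum_sum; last by move=> q i _ _; rewrite lee_fin mulr_ge0.
  rewrite -esumZl//; last by move=> q _; rewrite lee_fin mulr_ge0// wt_ge0.
  apply: le_esum => q _; rewrite sumEFin -EFinM lee_fin -mulr_suml !wg.
  rewrite [leRHS](_ : _ = (2 * (maxn #|zsupp p| 1 * maxn #|zsupp q| 1))%:R * (B p * B q)).
    by rewrite ler_wpM2r// -natr_sum ler_nat sum_indicator_le.
  by rewrite !natrM; ring.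
rewrite -EFinM lee_fin expr2 [leLHS]mulrA ler_wpM2r ?mulr_ge0//.
(* With s = alpha * lambda, 2^(s+1) * 2 = 2^(s+2) <= 2^(2s+1) because s > 1. *)
apply: (@le_trans _ _ (2 `^ (2 * alpha * lambda + 1))); last by rewrite lerDl.
rewrite -[X in _ * X]powRr1// -powRD; last by rewrite pnatr_eq0 implybT.
by apply: ler_powR; [rewrite ler1n|have := al; lra].
Qed.

Lemma cbc_error_bound :
  ((Num.sqrt 2)%:E * poweR (Ssum n alpha gamma z) (1 / 4) <=
     (Num.sqrt 2 * (2 `^ (2 * alpha * lambda + 1) + 1) `^ (1 / (4 * lambda))
         / (totient n)%:R `^ (1 / (4 * lambda))
         * wsum alpha gamma d lambda `^ (1 / (2 * lambda)))%:E)%E.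
Proof.
have /andP[l0 _] := l01.
have W0 := wsum_ge0; have S0 := Ssum_ge0.
have := cbc_Ssum_bound.
set W := wsum _ _ _ _ in W0 *; set kap := (2 `^ _ + 1).
have k0 : 0 <= kap by rewrite addr_ge0 ?powR_ge0.
have phi0 : 0 < (totient n)%:R :> R by rewrite ltr0n totient_gt0.
clearbody kap W.
(* An infinite S would contradict the preceding bound, as [totient n] is positive. *)
case: (Ssum n alpha gamma z) S0 => [x| |]//; last first.
  by move=> _; rewrite eqy_poweR// gt0_muley ?lte_fin// leye_eq.
rewrite lee_fin => x0 /=; rewrite -!EFinM !lee_fin -!mulrA => H.
rewrite ler_wpM2l ?sqrtr_ge0//.
have -> : x `^ (1 / 4) = (x `^ lambda) `^ (1 / (4 * lambda)).
  by rewrite -powRrM; congr (_ `^ _); field; rewrite gt_eqF.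
have e0 : 0 <= 1 / (4 * lambda) by rewrite divr_ge0// mulr_ge0// ltW.
have hK : x `^ lambda <= kap * ((totient n)%:R^-1 * W ^+ 2).
  by rewrite mulrCA ler_pdivlMl.
apply: le_trans (ge0_ler_powR e0 _ _ hK) _; rewrite ?nnegrE ?powR_ge0//.
  by rewrite !mulr_ge0 ?invr_ge0 ?ler0n ?exprn_ge0.
have V0 : 0 <= (totient n)%:R^-1 :> R by rewrite invr_ge0 ltW.
have W2 : 0 <= W ^+ 2 by exact: exprn_ge0.
rewrite (powRM _ k0 (mulr_ge0 V0 W2)) (powRM _ V0 W2).
rewrite ler_wpM2l ?powR_ge0//.
rewrite -[(totient n)%:R^-1]powR_inv1 ?ler0n// -powRrM mulN1r powRN ler_wpM2l ?invr_ge0 ?powR_ge0//.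
rewrite -powR_mulrn// -powRrM le_eqVlt; apply/orP; left; apply/eqP; congr (_ `^ _).
by field; rewrite gt_eqF.
Qed.

End cbc_bound.

(** * Iterated integrals of trigonometric polynomials *)

Section unit_interval_integrals.
Context {R : realType}.
Let mu : measure _ _ := @lebesgue_measure R.

Lemma cos_int (k : int) : cos (2 * pi * k%:~R) = 1 :> R.
Proof.
have cosn (m : nat) : cos (2 * pi * m%:R) = 1 :> R.
  rewrite (_ : 2 * pi * m%:R = 0 + (pi *+ 2) *+ m).
    by rewrite (periodicn (@cosD2pi R)) cos0.
  by rewrite add0r -mulrnA -[RHS]mulr_natl natrM; ring.
by case: k => m; [exact: cosn|rewrite NegzE mulrNz mulrN cosN; exact: cosn].
Qed.

Lemma sin_int (k : int) : sin (2 * pi * k%:~R) = 0 :> R.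
Proof. by apply/eqP; rewrite -norm_cos_eq1 cos_int normr1. Qed.

(** Continuity travels with the value because additivity of the integral requires integrability. *)
Definition cint (u : R -> R) (v : R) : Prop :=
  continuous u /\ (\int[mu]_(t in `[0%R, 1%R]) u t)%R = v.

Lemma cint_integrable u : continuous u -> mu.-integrable `[0%R, 1%R] (EFin \o u).
Proof.
move=> cu; apply: continuous_compact_integrable; first exact: segment_compact.
by apply: continuous_subspaceT => x; exact: cu.
Qed.

Lemma cint_cst c : cint (fun=> c) c.
Proof.
split; first by move=> x; exact: cvg_cst.
by rewrite Rintegral_cst//= lebesgue_measure_itv /= lte_fin ltr01 oppr0 adde0 mulr1.
Qed.

Lemma cintD u v a b : cint u a -> cint v b -> cint (fun t => u t + v t) (a + b).
Proof.
move=> [cu <-] [cv <-]; split; first by move=> x; apply: cvgD; [exact: cu|exact: cv].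
by rewrite RintegralD//; exact: cint_integrable.
Qed.

Lemma cint_sum (T : Type) (s : seq T) (u : T -> R -> R) (v : T -> R) :
  (forall e, cint (u e) (v e)) ->
  cint (fun t => \sum_(e <- s) u e t) (\sum_(e <- s) v e).
Proof.
move=> H; elim: s => [|e s IH].
  by rewrite big_nil; under eq_fun do rewrite big_nil; exact: cint_cst.
by rewrite big_cons; under eq_fun do rewrite big_cons; exact: cintD.
Qed.

Lemma cint_cos (a : R) (k : int) (phi : R) :
  cint (fun t => a * cos (2 * pi * (k%:~R * t) + phi)) (if k == 0 then a * cos phi else 0).
Proof.
have [->|k0] := eqVneq k 0.
  rewrite (_ : (fun t => _) = (fun=> a * cos phi)); first exact: cint_cst.
  by apply/funext => t; rewrite mulr0z mul0r mulr0 add0r.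
pose c : R := 2 * pi * k%:~R.
have c0 : c != 0 by rewrite mulf_neq0 ?intr_eq0// mulf_neq0// gt_eqF// pi_gt0.
rewrite (_ : (fun t => _) = (fun t : R => a * cos (c * t + phi))); last first.
  by apply/funext => t; rewrite mulrA.
pose F (t : R) : R := a / c * sin (c * t + phi).
have dL (t : R) : is_derive t (1:R) (fun t : R => c * t + phi) c.
  rewrite (_ : (fun t : R => _) = (c \*: (@id R) + cst phi)); last by apply/funext.
  apply: is_derive_eq.
  by rewrite addr0 /GRing.scale /= mulr1.
have dF (t : R) : is_derive t (1:R) F (a * cos (c * t + phi)).
  rewrite /F (_ : (fun t : R => _) = ((a / c) \*: (sin \o (fun t : R => c * t + phi)))); last by apply/funext.
  apply: is_derive_eq.
  by rewrite /GRing.scale /=; field.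
have cu : continuous (fun t : R => a * cos (c * t + phi)).
  move=> x; apply: cvgM; first exact: cvg_cst.
  apply: continuous_comp; last exact: continuous_cos.
  apply: cvgD; last exact: cvg_cst.
  by apply: cvgM; [exact: cvg_cst|exact: cvg_id].
split => //.
have cF : continuous F.
  by move=> x; apply/differentiable_continuous/derivable1_diffP; apply: ex_derive.
rewrite /Rintegral (@continuous_FTC2 _ _ F)//.
(* The frequency [k] is an integer, so the antiderivative takes equal values at both endpoints. *)
- rewrite /= /F mulr1 mulr0 add0r sinD cos_int sin_int; ring.
- by apply: continuous_subspaceT => x; exact: cu.
- split.
  + by move=> x _; apply: ex_derive.
  + exact/cvg_at_right_filter/cF.
  + exact/cvg_at_left_filter/cF.
- by move=> x _; rewrite derive1E; exact: derive_val.
Qed.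

(* No measurability is needed: the integral of a nonnegative function is the
   supremum of the integrals of the simple functions below it. *)
Lemma integral_mono_unit (u v : R -> R) (C : R) :
  (forall t, 0 <= u t <= v t) -> (forall t, v t <= C) ->
  [/\ 0 <= (\int[mu]_(t in `[0%R, 1%R]) u t)%R,
   (\int[mu]_(t in `[0%R, 1%R]) u t)%R <= (\int[mu]_(t in `[0%R, 1%R]) v t)%R &
   (\int[mu]_(t in `[0%R, 1%R]) v t)%R <= C].
Proof.
move=> uv vC.
have u0 t : 0 <= u t by case/andP: (uv t).
have v0 t : 0 <= v t by case/andP: (uv t) => h1 h2; exact: le_trans h2.
have mono (f g : R -> R) : (forall t, 0 <= f t) -> (forall t, f t <= g t) ->
    (\int[mu]_(t in `[0%R, 1%R]) (f t)%:E <= \int[mu]_(t in `[0%R, 1%R]) (g t)%:E)%E.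
  move=> f0 fg.
  have g0 t : 0 <= g t by exact: le_trans (fg t).
  rewrite !ge0_integralE; [|by move=> x _; rewrite lee_fin..].
  apply: ereal_sup_le => _ [h hf <-]; exists h => //= x.
  apply: le_trans (hf x) _; rewrite /patch; case: ifP => // _.
  by rewrite lee_fin.
have hC : (\int[mu]_(t in `[0%R, 1%R]) C%:E = C%:E)%E.
  rewrite integral_cst//= lebesgue_measure_itv /= lte_fin ltr01 oppr0 adde0 mule1//.
have hv := mono v (fun=> C) v0 vC; rewrite hC in hv.
have hu := mono u v u0 (fun t => proj2 (andP (uv t))).
have iu0 : (0 <= \int[mu]_(t in `[0%R, 1%R]) (u t)%:E)%E.
  by apply: integral_ge0 => t _; rewrite lee_fin.
(* Finiteness matters here: [fine] sends [+oo] to 0 and would destroy monotonicity. *)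
have fv : (\int[mu]_(t in `[0%R, 1%R]) (v t)%:E)%E \is a fin_num.
  by rewrite ge0_fin_numE ?(le_trans iu0)// (le_lt_trans hv)// ltry.
have fu : (\int[mu]_(t in `[0%R, 1%R]) (u t)%:E)%E \is a fin_num.
  by rewrite ge0_fin_numE// (le_lt_trans hu)// (le_lt_trans hv)// ltry.
split; rewrite /Rintegral.
- exact: fine_ge0.
- exact: fine_le.
- by rewrite -lee_fin fineK.
Qed.

(** The bound [C] belongs to the induction: it keeps the integral finite at every level. *)
Lemma iint_mono (d : nat) (g1 g2 : ('I_d -> R) -> R) (C : R) :
  (forall x, 0 <= g1 x <= g2 x) -> (forall x, g2 x <= C) ->
  [/\ 0 <= iint g1, iint g1 <= iint g2 & iint g2 <= C].
Proof.
elim: d g1 g2 => [|d IH] g1 g2 h12 h2.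
  by split => //=; case/andP: (h12 (fun=> 0)).
apply: integral_mono_unit => t.
  have [a b _] := IH (fun y => g1 (ocons t y)) (fun y => g2 (ocons t y))
    (fun y => h12 _) (fun y => h2 _).
  by rewrite a b.
by have [_ _] := IH (fun y => g1 (ocons t y)) (fun y => g2 (ocons t y))
    (fun y => h12 _) (fun y => h2 _).
Qed.

Definition ztl (d : nat) (h : Zvec d.+1) : Zvec d := [ffun j => h (lift ord0 j)].

Lemma dotR_ocons (d : nat) (h : Zvec d.+1) (t : R) (y : 'I_d -> R) :
  dotR h (ocons t y) = (h ord0)%:~R * t + dotR (ztl h) y.
Proof.
rewrite /dotR big_ord_recl /ocons unlift_none; congr (_ + _).
by apply: eq_bigr => j _; rewrite liftK ffunE.
Qed.

Lemma ztl_eq0 (d : nat) (h : Zvec d.+1) : (h == Zzero d.+1) = (h ord0 == 0) && (ztl h == Zzero d).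
Proof.
apply/eqP/andP => [->|[/eqP h0 /eqP ht]].
  by rewrite ffunE eqxx; split => //; apply/eqP/ffunP => j; rewrite !ffunE.
apply/ffunP => j; rewrite ffunE; case: (unliftP ord0 j) => [k|] ->//.
by have := congr1 (fun f : Zvec d => f k) ht; rewrite !ffunE.
Qed.

(* The phases absorb the coordinates already fixed, so that the induction on [d]
   goes through. *)
Lemma iint_trig (d : nat) (T : Type) (s : seq T) (h : T -> Zvec d) (a phi : T -> R) (c : R) :
  iint (fun x => \sum_(e <- s) a e * cos (2 * pi * dotR (h e) x + phi e) + c) =
  \sum_(e <- s) (if h e == Zzero d then a e * cos (phi e) else 0) + c.
Proof.
elim: d h phi => [|d IH] h phi.
  rewrite /=; congr (_ + _); apply: eq_bigr => e _.
  rewrite /dotR big_ord0 mulr0 add0r ifT//.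
  by apply/eqP/ffunP => -[].
rewrite /=.
have -> : (fun t => iint (fun y => \sum_(e <- s) a e * cos (2 * pi * dotR (h e) (ocons t y) + phi e) + c))
   = (fun t => \sum_(e <- s) (if ztl (h e) == Zzero d
       then a e * cos (2 * pi * ((h e ord0)%:~R * t) + phi e) else 0) + c).
  apply/funext => t.
  rewrite -(IH (fun e => ztl (h e)) (fun e => 2 * pi * ((h e ord0)%:~R * t) + phi e)).
  congr iint; apply/funext => y; congr (_ + _); apply: eq_bigr => e _.
  by rewrite dotR_ocons; congr (_ * cos _); ring.
have [_ ->//] : cint (fun t => \sum_(e <- s) (if ztl (h e) == Zzero d
       then a e * cos (2 * pi * ((h e ord0)%:~R * t) + phi e) else 0) + c)
  (\sum_(e <- s) (if h e == Zzero d.+1 then a e * cos (phi e) else 0) + c).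
apply: cintD; last exact: cint_cst.
apply: cint_sum => e; rewrite ztl_eq0.
case: (ztl (h e) == Zzero d); last by rewrite andbF; exact: cint_cst.
by rewrite andbT; exact: cint_cos.
Qed.

End unit_interval_integrals.

(** * Characters and signed sums over Z^d *)

Section characters.
Context {R : realType}.
Local Open Scope complex_scope.
Implicit Types (s t : R) (w u : R[i]).

Lemma ReM w u : complex.Re (w * u) = complex.Re w * complex.Re u - complex.Im w * complex.Im u.
Proof. by case: w => a b; case: u. Qed.

Lemma ImM w u : complex.Im (w * u) = complex.Re w * complex.Im u + complex.Im w * complex.Re u.
Proof. by case: w => a b; case: u. Qed.

Lemma ReD w u : complex.Re (w + u) = complex.Re w + complex.Re u.
Proof. by case: w => a b; case: u. Qed.

Lemma ImD w u : complex.Im (w + u) = complex.Im w + complex.Im u.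
Proof. by case: w => a b; case: u. Qed.

Lemma ReN w : complex.Re (- w) = - complex.Re w.
Proof. by case: w. Qed.

Lemma ImN w : complex.Im (- w) = - complex.Im w.
Proof. by case: w. Qed.

Lemma Re_sum (T : Type) (r : seq T) (F : T -> R[i]) :
  complex.Re (\sum_(e <- r) F e) = \sum_(e <- r) complex.Re (F e).
Proof. by elim: r => [|e r IH]; rewrite ?big_nil// !big_cons ReD IH. Qed.

Lemma Im_sum (T : Type) (r : seq T) (F : T -> R[i]) :
  complex.Im (\sum_(e <- r) F e) = \sum_(e <- r) complex.Im (F e).
Proof. by elim: r => [|e r IH]; rewrite ?big_nil// !big_cons ImD IH. Qed.

Lemma complexP w u : complex.Re w = complex.Re u -> complex.Im w = complex.Im u -> w = u.
Proof. by case: w => a b; case: u => c e /= -> ->. Qed.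

Lemma modC_sqr w : modC w ^+ 2 = complex.Re w ^+ 2 + complex.Im w ^+ 2.
Proof. by rewrite /modC sqr_sqrtr// addr_ge0// sqr_ge0. Qed.

Lemma Re_le_modC w : `|complex.Re w| <= modC w.
Proof.
rewrite -(@ler_pXn2r _ 2)// ?nnegrE ?sqrtr_ge0//.
by rewrite modC_sqr real_normK ?num_real// lerDl sqr_ge0.
Qed.

Lemma Im_le_modC w : `|complex.Im w| <= modC w.
Proof.
rewrite -(@ler_pXn2r _ 2)// ?nnegrE ?sqrtr_ge0//.
by rewrite modC_sqr real_normK ?num_real// lerDr sqr_ge0.
Qed.

Lemma exD s t : ex (s + t) = ex s * ex t.
Proof.
apply: complexP; rewrite ?ReM ?ImM /= mulrDr ?cosD ?sinD//.
by rewrite addrC.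
Qed.

Lemma ex_int (k : int) : ex (k%:~R : R) = 1.
Proof. by apply: complexP => /=; rewrite ?cos_int ?sin_int. Qed.

Lemma exMn t (k : nat) : ex (k%:R * t) = ex t ^+ k.
Proof.
elim: k => [|k IH]; first by rewrite mul0r expr0 (ex_int 0).
by rewrite -[k.+1]addn1 natrD mulrDl mul1r exD IH addn1 exprSr.
Qed.

(** Only the remainder 0 < r < n of [q] matters, and cos (2 pi r / n) = 1 - 2 sin^2 (pi r / n) < 1,
    since pi r / n lies strictly between 0 and pi. *)
Lemma ex_neq1 (q : int) (n : nat) : (0 < n)%N -> ~~ (n%:Z %| q)%Z -> ex (q%:~R / n%:R : R) != 1.
Proof.
move=> n0 nq.
have np : 0 < n%:R :> R by rewrite ltr0n.
pose r := absz (q %% n%:Z)%Z.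
have rE : (r%:Z = q %% n%:Z)%Z by rewrite /r gez0_abs// modz_ge0// eqz_nat -lt0n.
have rn : (r < n)%N by rewrite -ltz_nat rE ltz_pmod.
have r0 : (0 < r)%N.
  by rewrite lt0n absz_eq0; apply: contra nq => /eqP h; apply/dvdz_mod0P.
have -> : ex (q%:~R / n%:R : R) = ex (r%:R / n%:R).
  rewrite {1}(divz_eq q n%:Z) -rE intrD intrM mulrDl mulfK ?gt_eqF//.
  by rewrite exD ex_int mul1r.
apply/eqP => /(congr1 (@complex.Re R)) /=.
have rp : 0 < r%:R :> R by rewrite ltr0n.
have sp : 0 < sin (pi * (r%:R / n%:R)) :> R.
  apply: sin_gt0_pi; rewrite mulr_gt0 ?pi_gt0 ?divr_gt0//=.
  by rewrite gtr_pMr ?pi_gt0// ltr_pdivrMr// mul1r ltr_nat.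
have -> : 2 * pi * (r%:R / n%:R) = (pi * (r%:R / n%:R)) *+ 2 :> R.
  by rewrite -[RHS]mulr_natl mulrA.
rewrite cos_mulr2n cos2sin2 => h.
have : 0 < sin (pi * (r%:R / n%:R)) ^+ 2 :> R by rewrite exprn_gt0.
by move: h; lra.
Qed.

(** Taking fractional parts changes the scalar product by an integer, which the character does not
    see. *)
Lemma dotR_tpt (n d : nat) (z : 'I_d -> nat) (k : nat) (l : Zvec d) : (0 < n)%N ->
  ex (dotR l (tpt n z k) : R) = ex ((\sum_(j < d) l j * (z j)%:Z)%:~R / n%:R) ^+ k.
Proof.
move=> n0.
pose fl (j : 'I_d) : int := Num.floor (k%:R * (z j)%:R / n%:R : R).
have -> : dotR l (tpt n z k) = k%:R * ((\sum_(j < d) l j * (z j)%:Z)%:~R / n%:R)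
    + (- (\sum_(j < d) l j * fl j))%:~R :> R.
  rewrite mulrNz !rmorph_sum /= mulr_suml mulr_sumr -sumrB.
  apply: eq_bigr => j _; rewrite /tpt -/(fl j) !intrM mulrBr -pmulrn; congr (_ - _).
  by rewrite !mulrA; congr (_ / _); ring.
by rewrite exD ex_int mulr1 exMn.
Qed.

Lemma character_sum (n d : nat) (z : 'I_d -> nat) (l : Zvec d) : (0 < n)%N ->
  (n%:R)^-1 * \sum_(1 <= k < n.+1) ex (dotR l (tpt n z k) : R) = (dual_cond n z l)%:R.
Proof.
move=> n0; under eq_bigr do rewrite dotR_tpt//.
have nz : n%:R != 0 :> R[i] by rewrite pnatr_eq0 -lt0n.
rewrite /dual_cond; set q := \sum_(j < d) _; set w := ex _.
have [nq|nq] := boolP (n%:Z %| q)%Z.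
  have w1 : w = 1.
    have /dvdzP[m mE] := nq.
    by rewrite /w mE intrM mulfK ?ex_int// pnatr_eq0 -lt0n.
  rewrite w1; under eq_bigr do rewrite expr1n.
  by rewrite big_const_nat iter_addr addr0 subn1 /= mulVf.
have w1 : w != 1 by exact: ex_neq1.
have wn : w ^+ n = 1.
  by rewrite -exMn mulrCA divff ?mulr1 ?ex_int// pnatr_eq0 -lt0n.
suff -> : \sum_(1 <= k < n.+1) w ^+ k = 0 by rewrite mulr0.
rewrite big_add1 /= big_mkord; under eq_bigr do rewrite exprS.
rewrite -mulr_sumr; apply/eqP; rewrite mulf_eq0; apply/orP; right.
have := subrX1 w n; rewrite wn subrr => /esym/eqP; rewrite mulf_eq0 subr_eq0.
by rewrite (negbTE w1).
Qed.

Lemma Re_ex_le w t : `|complex.Re (w * ex t)| <= `|complex.Re w| + `|complex.Im w|.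
Proof.
rewrite ReM /=; apply: le_trans (ler_normB _ _) _; rewrite !normrM.
by rewrite lerD// ler_piMr// ?cos_max ?sin_max.
Qed.

Lemma Im_ex_le w t : `|complex.Im (w * ex t)| <= `|complex.Re w| + `|complex.Im w|.
Proof.
rewrite ImM /=; apply: le_trans (ler_normD _ _) _; rewrite !normrM.
by rewrite lerD// ler_piMr// ?cos_max ?sin_max.
Qed.

End characters.

(** * Signed sums controlled by a dominating series *)

Section signed_sums.
Context {R : realType}.

Lemma esum_compl_seq (T : choiceType) (b : T -> R) (v : R) (F : seq T) : uniq F ->
  (forall x, 0 <= b x) -> (\esum_(x in [set: T]) (b x)%:E = v%:E)%E ->
  (\esum_(x in ~` [set` F]) (b x)%:E = (v - \sum_(x <- F) b x)%:E)%E.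
Proof.
move=> uF b0; rewrite (esumID [set` F]); last by move=> x _; rewrite lee_fin.
rewrite !setTI [X in (X + _)%E]esum_fset; last 2 first.
- exact: finite_seq.
- by move=> x _; rewrite lee_fin.
rewrite -fsbig_seq// sumEFin => H.
by rewrite EFinB -H [X in (X - _)%E]addeC addeK.
Qed.

Lemma esum_adherent (T : choiceType) (A : T -> R) (C e : R) :
  (\esum_(x in [set: T]) (A x)%:E = C%:E)%E -> 0 < e ->
  exists2 F : seq T, uniq F & C - \sum_(x <- F) A x < e.
Proof.
move=> hC e0; apply: contrapT => H.
suff : (\esum_(x in [set: T]) (A x)%:E <= (C - e)%:E)%E.
  by rewrite hC lee_fin; lra.
apply: esum_le_seq => F uF; rewrite sumEFin lee_fin leNgt; apply/negP => h.
by apply: H; exists F => //; lra.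
Qed.

Context (d : nat).
Implicit Types (a A : Zvec d -> R).

Lemma sumRZ_approx a A (C : R) (F : seq (Zvec d)) : uniq F ->
  (forall h, `|a h| <= A h) -> (\esum_(h in [set: Zvec d]) (A h)%:E = C%:E)%E ->
  `|sumRZ a - \sum_(h <- F) a h| <= C - \sum_(h <- F) A h.
Proof.
move=> uF aA hC.
have A0 h : 0 <= A h by exact: le_trans (aA h).
pose ap h := Num.max (a h) 0; pose am h := Num.max (- a h) 0.
have ap0 h : 0 <= ap h by rewrite /ap le_max lexx orbT.
have am0 h : 0 <= am h by rewrite /am le_max lexx orbT.
have apA h : ap h <= A h by rewrite /ap ge_max A0 andbT (le_trans (ler_norm _)).
have amA h : am h <= A h by rewrite /am ge_max A0 andbT (le_trans (ler_norm _))// normrN.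
have fin (b : Zvec d -> R) : (forall h, 0 <= b h) -> (forall h, b h <= A h) ->
    (\esum_(h in [set: Zvec d]) (b h)%:E = (fine (\esum_(h in [set: Zvec d]) (b h)%:E))%:E)%E.
  move=> b0 bA; rewrite fineK// ge0_fin_numE; last by apply: esum_ge0 => h _; rewrite lee_fin.
  apply: (@le_lt_trans _ _ C%:E); last by rewrite ltry.
  by rewrite -hC; apply: le_esum => h _; rewrite lee_fin.
have hp := esum_compl_seq uF ap0 (fin _ ap0 apA).
have hm := esum_compl_seq uF am0 (fin _ am0 amA).
have hA := esum_compl_seq uF A0 hC.
rewrite /sumRZ -/ap -/am; set P := fine _ in hp *; set N := fine _ in hm *.
have aE h : a h = ap h - am h.
  by rewrite /ap /am; case: (leP (a h) 0) => h1; case: (leP (- a h) 0) => h2; lra.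
under eq_bigr do rewrite aE.
rewrite sumrB.
have hp0 : 0 <= P - \sum_(h <- F) ap h.
  by rewrite -lee_fin -hp; apply: esum_ge0 => h _; rewrite lee_fin.
have hm0 : 0 <= N - \sum_(h <- F) am h.
  by rewrite -lee_fin -hm; apply: esum_ge0 => h _; rewrite lee_fin.
(* The tails of the positive and negative parts add up to the tail of |a|, so both together stay
   below a single tail of [A]. *)
have hs : (P - \sum_(h <- F) ap h) + (N - \sum_(h <- F) am h) <= C - \sum_(h <- F) A h.
  rewrite -lee_fin EFinD -hp -hm -hA -esumD => [|h _|h _]; rewrite ?lee_fin//.
  apply: le_esum => h _; rewrite -EFinD lee_fin (le_trans _ (aA h))//.
  by rewrite /ap /am; case: (ler0P (a h)) => h1; case: (leP (- a h) 0) => h2; lra.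
rewrite ler_norml; lra.
Qed.

(** If [v] differed from the sum, a finite [F] whose tail is below half the distance would
    contradict the triangle inequality. *)
Lemma sumRZ_unique a A (C v : R) :
  (forall h, `|a h| <= A h) -> (\esum_(h in [set: Zvec d]) (A h)%:E = C%:E)%E ->
  (forall F, uniq F -> `|v - \sum_(h <- F) a h| <= C - \sum_(h <- F) A h) ->
  v = sumRZ a.
Proof.
move=> aA hC hv; apply/eqP; rewrite -subr_eq0 -normr_le0 leNgt; apply/negP => e0.
have [F uF hF] := esum_adherent hC (divr_gt0 e0 (ltr0Sn _ 1)).
have := sumRZ_approx uF aA hC; have := hv F uF.
move: hF e0; rewrite ltr_pdivlMr//.
set S := \sum_(h <- F) a h; set X := _ - \sum_(h <- F) A h.
move=> h1 _ h2 h3.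
have := ler_normB (v - S) (sumRZ a - S).
rewrite opprB addrA subrK => h4; clear -h1 h2 h3 h4; lra.
Qed.

(** Two families are combined at once because the real part of a complex product mixes real and
    imaginary parts. *)
Lemma sumRZ_lin (T : Type) (s : seq T) (w w' : T -> R) (a a' : T -> Zvec d -> R) A (C : R) :
  (forall h, 0 <= A h) ->
  (forall e h, `|a e h| <= A h) -> (forall e h, `|a' e h| <= A h) ->
  (\esum_(h in [set: Zvec d]) (A h)%:E = C%:E)%E ->
  \sum_(e <- s) (w e * sumRZ (a e) + w' e * sumRZ (a' e)) =
  sumRZ (fun h => \sum_(e <- s) (w e * a e h + w' e * a' e h)).
Proof.
move=> A0 aA aA' hC.
pose K := \sum_(e <- s) (`|w e| + `|w' e|).
have K0 : 0 <= K by apply: sumr_ge0 => e _; rewrite addr_ge0.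
apply: (@sumRZ_unique _ (fun h => K * A h) (K * C)).
- move=> h; apply: le_trans (ler_norm_sum _ _ _) _; rewrite /K mulr_suml; apply: ler_sum => e _.
  apply: le_trans (ler_normD _ _) _; rewrite !normrM mulrDl.
  by rewrite lerD// ler_wpM2l.
- by rewrite esumZl_real ?hC.
- move=> F uF; rewrite exchange_big -sumrB /=; apply: le_trans (ler_norm_sum _ _ _) _.
  rewrite -mulr_sumr -mulrBr /K mulr_suml; apply: ler_sum => e _.
  rewrite big_split /= -!mulr_sumr opprD addrACA -!mulrBr.
  apply: le_trans (ler_normD _ _) _; rewrite !normrM mulrDl.
  by rewrite lerD// ler_wpM2l// (sumRZ_approx uF _ hC).
Qed.

Lemma sumCZ_lin (T : Type) (s : seq T) (w : T -> R[i]) (c : T -> Zvec d -> R[i]) A (C : R) :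
  (forall h, 0 <= A h) ->
  (forall e h, `|complex.Re (c e h)| <= A h) -> (forall e h, `|complex.Im (c e h)| <= A h) ->
  (\esum_(h in [set: Zvec d]) (A h)%:E = C%:E)%E ->
  \sum_(e <- s) w e * sumCZ (c e) = sumCZ (fun h => \sum_(e <- s) w e * c e h).
Proof.
move=> A0 cr ci hC; apply: complexP; rewrite /= ?Re_sum ?Im_sum.
  under eq_bigr do rewrite ReM /= -mulNr.
  rewrite (sumRZ_lin _ _ _ A0 cr ci hC); congr sumRZ; apply/funext => h.
  by rewrite Re_sum; apply: eq_bigr => e _; rewrite ReM mulNr.
under eq_bigr do rewrite ImM /=.
rewrite (sumRZ_lin _ _ _ A0 ci cr hC); congr sumRZ; apply/funext => h.
by rewrite Im_sum; apply: eq_bigr => e _; rewrite ImM.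
Qed.

End signed_sums.

(** * The L2 error of the lattice approximation *)

Section bessel.
Context {R : realType} (d : nat).

Definition Zsub (h l : Zvec d) : Zvec d := [ffun j => h j - l j].

Lemma Zsub_eq0 (h l : Zvec d) : (Zsub h l == Zzero d) = (h == l).
Proof.
apply/eqP/eqP => [H|->]; apply/ffunP => j; last by rewrite !ffunE subrr.
by apply/eqP; rewrite -subr_eq0; have := congr1 (fun f : Zvec d => f j) H; rewrite !ffunE => ->.
Qed.

Lemma dotR_sub (h l : Zvec d) (x : 'I_d -> R) : dotR (Zsub h l) x = dotR h x - dotR l x.
Proof. by rewrite /dotR -sumrB; apply: eq_bigr => j _; rewrite ffunE rmorphB mulrBl. Qed.

Variable c : Zvec d -> R[i].

Let re h x : R := complex.Re (c h * ex (dotR h x)).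
Let im h x : R := complex.Im (c h * ex (dotR h x)).

(** The squared modulus expands into cosines and sines of the frequencies h - l. A sine is a cosine
    with phase -pi/2, which is the role of the Boolean index, so [iint_trig] applies; only the
    diagonal h = l has frequency zero. *)
Lemma iint_trig_sqr (F : seq (Zvec d)) (e : R) : uniq F ->
  iint (fun x => (\sum_(h <- F) re h x) ^+ 2 + (\sum_(h <- F) im h x) ^+ 2 + e) =
  \sum_(h <- F) modC (c h) ^+ 2 + e.
Proof.
move=> uF.
pose cr h := complex.Re (c h); pose ci h := complex.Im (c h).
pose s := [seq (pq, b) | pq <- [seq (h, l) | h <- F, l <- F], b <- [:: true; false]].
pose a (k : Zvec d * Zvec d * bool) : R := let: (h, l, b) := k in
  if b then cr h * cr l + ci h * ci l else cr h * ci l - ci h * cr l.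
pose phi (k : Zvec d * Zvec d * bool) : R := if k.2 then 0 else - (pi / 2).
pose D (k : Zvec d * Zvec d * bool) := Zsub k.1.1 k.1.2.
have sE (G : Zvec d * Zvec d * bool -> R) : \sum_(k <- s) G k =
    \sum_(h <- F) \sum_(l <- F) (G (h, l, true) + G (h, l, false)).
  by rewrite /s big_allpairs big_allpairs; apply: eq_bigr => h _; apply: eq_bigr => l _;
    rewrite !big_cons big_nil /= addr0.
have -> : (fun x => (\sum_(h <- F) re h x) ^+ 2 + (\sum_(h <- F) im h x) ^+ 2 + e) =
    (fun x => \sum_(k <- s) a k * cos (2 * pi * dotR (D k) x + phi k) + e).
  apply/funext => x; congr (_ + _); rewrite sE !expr2 !big_distrlr -big_split /=.
  apply: eq_bigr => h _; rewrite -big_split /=; apply: eq_bigr => l _.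
  have cosS (t : R) : cos (t - pi / 2) = sin t.
    by rewrite cosB cos_pihalf sin_pihalf mulr0 add0r mulr1.
  rewrite /re /im !ReM !ImM /= -/(cr h) -/(ci h) -/(cr l) -/(ci l) /D /phi /=.
  by rewrite dotR_sub addr0 cosS (mulrBr (2 * pi)) cosB sinB; ring.
rewrite iint_trig sE; congr (_ + _).
apply: eq_big_seq => h hF; rewrite (bigD1_seq h)//= big1 => [|l lh].
  by rewrite Zsub_eq0 eqxx /phi /= cos0 cosN cos_pihalf modC_sqr -/(cr h) -/(ci h); ring.
by rewrite /D /= Zsub_eq0 eq_sym (negbTE lh) addr0.
Qed.

Lemma iint_sq_le (g : ('I_d -> R) -> R[i]) (C : R) :
  (\esum_(h in [set: Zvec d]) (`|complex.Re (c h)| + `|complex.Im (c h)|)%:E = C%:E)%E ->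
  (forall x, g x = sumCZ (fun h => c h * ex (dotR h x))) ->
  ((iint (fun x => modC (g x) ^+ 2))%:E <= \esum_(h in [set: Zvec d]) (modC (c h) ^+ 2)%:E)%E.
Proof.
move=> hC hg.
pose A h : R := `|complex.Re (c h)| + `|complex.Im (c h)|.
have A0 h : 0 <= A h by rewrite addr_ge0.
have C0 : 0 <= C by rewrite -lee_fin -hC; apply: esum_ge0 => h _; rewrite lee_fin.
apply/lee_addgt0Pr => e e0.
(* With tails below eps, replacing a real or imaginary part by its partial sum costs at most eps (2C
   + eps) in the square. Two parts must cost at most [e], and eps <= 1 makes this condition linear
   in eps. *)
pose eps : R := Num.min 1 (e / (2 * (2 * C + 1))).
have K0 : 0 < 2 * (2 * C + 1) by clear hC hg; lra.
have eps0 : 0 < eps by rewrite lt_min ltr01 divr_gt0.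
have epse : 2 * (eps * (2 * C + eps)) <= e.
  have h1 : eps <= 1 by rewrite ge_min lexx.
  have h2 : eps * (2 * (2 * C + 1)) <= e by rewrite -ler_pdivlMr// ge_min lexx orbT.
  have h3 : eps * eps <= eps by rewrite ler_piMl// ltW.
  by clear hC hg; lra.
have [F uF hF] := esum_adherent hC eps0.
have SC : \sum_(h <- F) A h <= C.
  by rewrite -lee_fin -hC -sumEFin seq_le_esum.
have near (b : Zvec d -> R) v : (forall h, `|b h| <= A h) -> v = sumRZ b ->
    v ^+ 2 <= (\sum_(h <- F) b h) ^+ 2 + eps * (2 * C + eps) /\ (\sum_(h <- F) b h) ^+ 2 <= C ^+ 2.
  move=> bA ->; have := sumRZ_approx uF bA hC.
  have : `|\sum_(h <- F) b h| <= C.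
    by apply: le_trans (ler_norm_sum _ _ _) _; apply: le_trans SC; apply: ler_sum.
  set u := \sum_(h <- F) b h; set v' := sumRZ b; set X := C - _ in hF *.
  move=> uC vX; have {}vX : `|v' - u| <= eps by exact: le_trans vX (ltW hF).
  split; last by rewrite -[leLHS]real_normK ?num_real// ler_pXn2r ?nnegrE.
  rewrite -[v'](subrK u) sqrrD -[X in X + _ + _]real_normK ?num_real//.
  have h1 : `|v' - u| ^+ 2 <= eps ^+ 2 by rewrite ler_pXn2r ?nnegrE// ltW.
  have h2 : (v' - u) * u <= eps * C.
    by rewrite (le_trans (ler_norm _))// normrM ler_pM.
  rewrite -mulr_natr; clear hC hg; rewrite !expr2 in h1 *; lra.
have pt x : modC (g x) ^+ 2 <= (\sum_(h <- F) re h x) ^+ 2 + (\sum_(h <- F) im h x) ^+ 2 + e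
   /\ (\sum_(h <- F) re h x) ^+ 2 + (\sum_(h <- F) im h x) ^+ 2 + e <= C ^+ 2 + C ^+ 2 + e.
  have [r1 r2] := near (fun h => re h x) (complex.Re (g x))
    (fun h => Re_ex_le _ _) (congr1 (@complex.Re R) (hg x)).
  have [i1 i2] := near (fun h => im h x) (complex.Im (g x))
    (fun h => Im_ex_le _ _) (congr1 (@complex.Im R) (hg x)).
  by rewrite modC_sqr; clear hC hg; split; lra.
have [_ h2 _] := @iint_mono R d (fun x => modC (g x) ^+ 2)
  (fun x => (\sum_(h <- F) re h x) ^+ 2 + (\sum_(h <- F) im h x) ^+ 2 + e) (C ^+ 2 + C ^+ 2 + e)
  (fun x => introT andP (conj (sqr_ge0 _) (proj1 (pt x)))) (fun x => proj2 (pt x)).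
rewrite iint_trig_sqr// in h2.
apply: (@le_trans _ _ (\sum_(h <- F) modC (c h) ^+ 2 + e)%:E); first by rewrite lee_fin.
by rewrite EFinD leeD2r// -sumEFin seq_le_esum.
Qed.

End bessel.

(** * Aliasing and the L2 bound for a single function *)

Section lattice_error.
Context {R : realType} (n d : nat) (alpha : R) (gamma : {fset nat} -> R) (z : 'I_d -> nat).
Hypotheses (n0 : (0 < n)%N) (a1 : 1 < alpha) (g0 : forall u, 0 < gamma u).
Local Open Scope complex_scope.

Let r (h : Zvec d) : R := rfun alpha gamma h.
Let b (h : Zvec d) : R := (r h)^-1.

Let r_gt0 h : 0 < r h.
Proof. by rewrite -invr_gt0 /r rfun_inv wt_gt0. Qed.

Let b_ge0 h : 0 <= b h.
Proof. by rewrite invr_ge0 ltW. Qed.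

Lemma esum_rfun_inv_fin : exists Cb : R, (\esum_(h in [set: Zvec d]) (b h)%:E = Cb%:E)%E.
Proof.
have H := esum_wt d (fun u => ltW (g0 u)) a1.
eexists; apply: etrans H.
by apply: eq_esum => h _; rewrite /b /r rfun_inv.
Qed.

Section aliasing.
Variables (f : ('I_d -> R) -> R[i]) (C : R).
Let c := fourier f.
Let A h : R := `|complex.Re (c h)| + `|complex.Im (c h)|.
Hypothesis hC : (\esum_(h in [set: Zvec d]) (A h)%:E = C%:E)%E.
Hypothesis hf : forall x, f x = sumCZ (fun h => c h * ex (dotR h x)).

Let A0 h : 0 <= A h. Proof. by rewrite addr_ge0. Qed.

(** After inserting the Fourier series and exchanging the sums, the character sum over the lattice
    points keeps exactly the [m] with m - h in the dual lattice. *)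
Lemma fhat_a_alias h :
  fhat_a n z f h = sumCZ (fun m => (dual_cond n z (Zsub m h))%:R * c m).
Proof.
rewrite /fhat_a mulr_sumr.
transitivity (\sum_(k <- index_iota 1 n.+1) (n%:R^-1 * ex (- dotR h (tpt n z k))) *
   sumCZ (fun m => c m * ex (dotR m (tpt n z k)))).
  by apply: eq_bigr => k _; rewrite hf mulrCA mulrC -mulrA.
rewrite (sumCZ_lin _ _ A0 (C := C))//.
- congr sumCZ; apply/funext => m.
  rewrite -(character_sum (R := R) z (Zsub m h) n0) [RHS]mulrAC [RHS]mulr_sumr.
  apply: eq_bigr => k _; rewrite dotR_sub exD.
  by rewrite -!mulrA; congr (_ * _); ring.
- by move=> k m; exact: Re_ex_le.
- by move=> k m; exact: Im_ex_le.
Qed.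

Lemma Re_indic (t : bool) (w : R[i]) : complex.Re (t%:R * w) = t%:R * complex.Re w.
Proof. by case: t; rewrite ?mul1r ?mul0r. Qed.

Lemma Im_indic (t : bool) (w : R[i]) : complex.Im (t%:R * w) = t%:R * complex.Im w.
Proof. by case: t; rewrite ?mul1r ?mul0r. Qed.

Let ind h m : bool := (m != h) && dual_cond n z (Zsub m h).
Let alias (u : Zvec d -> R) h : R := sumRZ (fun m => (dual_cond n z (Zsub m h))%:R * u m).

Lemma indic_norm_le (t : bool) (y : R) : `|t%:R * y| <= `|y|.
Proof. by case: t; rewrite ?mul1r ?mul0r ?normr0. Qed.

Lemma alias_bound u h : (forall m, `|u m| <= A m) -> `|alias u h| <= C.
Proof.
move=> uA.
have := @sumRZ_approx R d (fun m => (dual_cond n z (Zsub m h))%:R * u m) A C [::] isT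
  (fun m => le_trans (indic_norm_le _ _) (uA m)) hC.
by rewrite !big_nil !subr0.
Qed.

(** The frequency [h] itself is among its aliases, so this is the tail estimate for the one-element
    set {h}, with the absolute values of the terms as dominating series. *)
Lemma alias_diff u h : (forall m, `|u m| <= A m) ->
  exists2 V : R, (\esum_(m in [set: Zvec d]) ((ind h m)%:R * `|u m|)%:E = V%:E)%E &
    `|u h - alias u h| <= V.
Proof.
move=> uA; pose a m := (dual_cond n z (Zsub m h))%:R * u m.
have aA m : `|a m| <= A m by exact: le_trans (indic_norm_le _ _) (uA m).
have hv : (\esum_(m in [set: Zvec d]) (`|a m|)%:E =
    (fine (\esum_(m in [set: Zvec d]) (`|a m|)%:E))%:E)%E.
  rewrite fineK// ge0_fin_numE; last by apply: esum_ge0 => m _; rewrite lee_fin.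
  apply: (@le_lt_trans _ _ C%:E); last by rewrite ltry.
  by rewrite -hC; apply: le_esum => m _; rewrite lee_fin.
set v := fine _ in hv.
have ah : a h = u h.
  rewrite /a (_ : dual_cond _ _ _ = true) ?mul1r// /dual_cond big1 ?dvdz0// => j _.
  by rewrite ffunE subrr mul0r.
exists (v - `|a h|).
  have := @esum_compl_seq R _ (fun m => `|a m|) v [:: h] isT (fun m => normr_ge0 _) hv.
  rewrite big_seq1 => <-.
  rewrite (@esum_indicator _ _ _ (fun m => m != h)); last first.
    move=> m /=; rewrite inE; split => [/negP//|/negP//].
  apply: eq_esum => m _; rewrite /a /ind normrM normr_nat mulrA -natrM mulnb.
  by [].
have := @sumRZ_approx R d a (fun m => `|a m|) v [:: h] isT (fun m => lexx _) hv.
by rewrite !big_seq1 -ah distrC.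
Qed.

(** Cauchy-Schwarz with the weight [r] on the coefficients and its inverse [b] on the aliasing
    frequencies. *)
Lemma alias_sqr u h (Ku Q : R) : (forall m, `|u m| <= A m) ->
  (\esum_(m in [set: Zvec d]) (u m ^+ 2 * r m)%:E <= Ku%:E)%E ->
  (\esum_(m in [set: Zvec d]) ((ind h m)%:R * b m)%:E = Q%:E)%E ->
  (u h - alias u h) ^+ 2 <= Ku * Q.
Proof.
move=> uA hK hQ; have [V hV Vle] := alias_diff h uA.
have V0 : 0 <= V by exact: le_trans Vle.
apply: (@le_trans _ _ (V ^+ 2)).
  by rewrite -[leLHS]real_normK ?num_real// ler_pXn2r ?nnegrE.
apply: (@esum_cauchy_schwarz _ _ (fun m => (ind h m)%:R * `|u m|)
  (fun m => u m ^+ 2 * r m) (fun m => (ind h m)%:R * b m)) => //.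
- by move=> m; apply: mulr_ge0; [exact: sqr_ge0|exact: ltW].
- by move=> m; apply: mulr_ge0 => //; exact: b_ge0.
- move=> m; rewrite exprMn real_normK ?num_real// /b.
  have rm : r m != 0 by rewrite gt_eqF.
  by case: ind; rewrite ?mul0r ?mulr0 ?expr0n ?mul0r// expr1n !mul1r mulfK.
- by rewrite hQ.
Qed.

Lemma lattice_L2_bound (M x : R) : 0 < M ->
  Ssum n alpha gamma z = x%:E -> (knorm2 alpha gamma f <= 1)%E ->
  iint (fun y => modC (f y - An n alpha gamma M z f y) ^+ 2) <= M^-1 + M * x.
Proof.
move=> M0 hS hK.
have [Cb hCb] := esum_rfun_inv_fin.
have C0 : 0 <= C by rewrite -lee_fin -hC; apply: esum_ge0 => h _; rewrite lee_fin.
have reA m : `|complex.Re (c m)| <= A m by rewrite lerDl.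
have imA m : `|complex.Im (c m)| <= A m by rewrite lerDr.
have faRe h : complex.Re (fhat_a n z f h) = alias (fun m => complex.Re (c m)) h.
  rewrite fhat_a_alias /= /alias; congr sumRZ; apply/funext => m; exact: Re_indic.
have faIm h : complex.Im (fhat_a n z f h) = alias (fun m => complex.Im (c m)) h.
  rewrite fhat_a_alias /= /alias; congr sumRZ; apply/funext => m; exact: Im_indic.
pose fa h : R[i] := if r h <= M then fhat_a n z f h else 0.
pose c' h := c h - fa h.
have Mb h : r h <= M -> 1 <= M * b h by move=> rM; rewrite ler_pdivlMr// mul1r.
have Mb0 h : 0 <= M * b h by rewrite mulr_ge0// ltW.
(* Approximate coefficients are bounded by a constant only, which is not summable over Z^d; on the
   index set 1 <= M b(h), so the factor [M * b h] gives a summable majorant. *)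
pose A' h : R := A h + 2 * C * (M * b h).
have A'0 h : 0 <= A' h by rewrite addr_ge0// mulr_ge0// mulr_ge0.
have fab h : `|complex.Re (fa h)| + `|complex.Im (fa h)| <= 2 * C * (M * b h).
  rewrite /fa; case: ifP => [rM|_] /=; last by rewrite normr0 addr0 mulr_ge0// mulr_ge0.
  apply: (@le_trans _ _ (2 * C)); last by rewrite ler_peMr ?Mb// mulr_ge0.
  rewrite mulr_natl mulr2n faRe faIm lerD//; exact: alias_bound.
have hA' : (\esum_(h in [set: Zvec d]) (A' h)%:E = (C + 2 * C * (M * Cb))%:E)%E.
  under eq_esum do rewrite EFinD.
  rewrite esumD => [|h _|h _]; last 2 first.
  - by rewrite lee_fin.
  - by rewrite lee_fin mulr_ge0// mulr_ge0.
  rewrite hC EFinD esumZl_real ?mulr_ge0//; congr (_ + _)%E.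
  by rewrite esumZl_real ?(ltW M0)// hCb -!EFinM.
have gE y : f y - An n alpha gamma M z f y = sumCZ (fun h => c' h * ex (dotR h y)).
  pose fam (e : bool) (h : Zvec d) : R[i] := (if e then c h else fa h) * ex (dotR h y).
  have -> : (fun h => c' h * ex (dotR h y)) =
      (fun h => \sum_(e <- [:: true; false]) (if e then 1 else -1) * fam e h).
    apply/funext => h; rewrite !big_cons big_nil addr0 mul1r mulN1r.
    by rewrite /fam /c' mulrBl.
  rewrite -(@sumCZ_lin R d bool [:: true; false] (fun e => if e then 1 else -1) fam
    A' _ A'0 _ _ hA').
  - rewrite !big_cons big_nil addr0 mul1r mulN1r hf; congr (_ - _); rewrite /An; congr sumCZ; apply/funext => h.
    by rewrite /fam /fa /r; case: ifP; rewrite ?mul0r.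
  - move=> e h; apply: le_trans (Re_ex_le _ _) _; case: e; rewrite /A'.
      by rewrite lerDl mulr_ge0// mulr_ge0.
    by apply: le_trans (fab h) _; rewrite lerDr.
  - move=> e h; apply: le_trans (Im_ex_le _ _) _; case: e; rewrite /A'.
      by rewrite lerDl mulr_ge0// mulr_ge0.
    by apply: le_trans (fab h) _; rewrite lerDr.
have c'A h : `|complex.Re (c' h)| + `|complex.Im (c' h)| <= A' h.
  rewrite /c' ReD ImD ReN ImN.
  have h1 := ler_normB (complex.Re (c h)) (complex.Re (fa h)).
  have h2 := ler_normB (complex.Im (c h)) (complex.Im (fa h)).
  apply: le_trans (lerD h1 h2) _; rewrite addrACA lerD//.
have c'0 h : 0 <= `|complex.Re (c' h)| + `|complex.Im (c' h)| by rewrite addr_ge0.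
have hC' : (\esum_(h in [set: Zvec d]) (`|complex.Re (c' h)| + `|complex.Im (c' h)|)%:E =
    (fine (\esum_(h in [set: Zvec d]) (`|complex.Re (c' h)| + `|complex.Im (c' h)|)%:E))%:E)%E.
  rewrite fineK// ge0_fin_numE; last by apply: esum_ge0 => m _; rewrite lee_fin.
  apply: (@le_lt_trans _ _ (C + 2 * C * (M * Cb))%:E); last by rewrite ltry.
  by rewrite -hA'; apply: le_esum => m _; rewrite lee_fin.
rewrite -lee_fin; apply: le_trans (iint_sq_le hC' gE) _.
have knE : (\esum_(h in [set: Zvec d]) (complex.Re (c h) ^+ 2 * r h)%:E +
    \esum_(h in [set: Zvec d]) (complex.Im (c h) ^+ 2 * r h)%:E <= 1%:E)%E.
  rewrite -esumD => [|h _|h _]; try by rewrite lee_fin mulr_ge0 ?sqr_ge0// ltW.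
  apply: le_trans hK; rewrite /knorm2; apply: le_esum => h _.
  by rewrite -EFinD lee_fin -mulrDl modC_sqr.
have re0 : (0 <= \esum_(h in [set: Zvec d]) (complex.Re (c h) ^+ 2 * r h)%:E)%E.
  by apply: esum_ge0 => h _; rewrite lee_fin mulr_ge0 ?sqr_ge0// ltW.
have im0 : (0 <= \esum_(h in [set: Zvec d]) (complex.Im (c h) ^+ 2 * r h)%:E)%E.
  by apply: esum_ge0 => h _; rewrite lee_fin mulr_ge0 ?sqr_ge0// ltW.
(* Aliasing is estimated separately for real and imaginary parts; their shares of the squared norm
   satisfy Kr + Ki <= 1, so no factor 2 is lost. *)
have [Kr hKr] : exists Kr : R, (\esum_(h in [set: Zvec d]) (complex.Re (c h) ^+ 2 * r h)%:E = Kr%:E)%E.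
  eexists; apply/esym/fineK; rewrite ge0_fin_numE//.
  by apply: (@le_lt_trans _ _ 1%:E); [apply: le_trans knE; exact: leeDl|rewrite ltry].
have [Ki hKi] : exists Ki : R, (\esum_(h in [set: Zvec d]) (complex.Im (c h) ^+ 2 * r h)%:E = Ki%:E)%E.
  eexists; apply/esym/fineK; rewrite ge0_fin_numE//.
  by apply: (@le_lt_trans _ _ 1%:E); [apply: le_trans knE; exact: leeDr|rewrite ltry].
rewrite hKr hKi -EFinD lee_fin in knE.
have indb h m : 0 <= (ind h m)%:R * b m by apply: mulr_ge0 => //; exact: b_ge0.
have hQ h : (\esum_(m in [set: Zvec d]) ((ind h m)%:R * b m)%:E =
   (fine (\esum_(m in [set: Zvec d]) ((ind h m)%:R * b m)%:E))%:E)%E.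
  rewrite fineK// ge0_fin_numE; last by apply: esum_ge0 => m _; rewrite lee_fin.
  apply: (@le_lt_trans _ _ Cb%:E); last by rewrite ltry.
  rewrite -hCb; apply: le_esum => m _; rewrite lee_fin.
  by case: (ind h m); rewrite ?mul1r ?mul0r.
pose Q h : R := fine (\esum_(m in [set: Zvec d]) ((ind h m)%:R * b m)%:E)%E.
have Q0 h : 0 <= Q h by apply: fine_ge0; apply: esum_ge0 => m _; rewrite lee_fin.
have QS h : (\esum_(l in [set l : Zvec d | l != Zzero d /\ dual_cond n z l])
    ((rfun alpha gamma (Zadd h l))^-1%R)%:E = (Q h)%:E)%E.
  rewrite (@esum_indicator _ _ _ (fun l => (l != Zzero d) && dual_cond n z l)); last first.
    by move=> l /=; split => [[-> ->]//|/andP[]].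
  rewrite -hQ [RHS](esum_reindex_bij _ (Zadd_bij h)); apply: eq_esum => l _.
  have e : Zsub (Zadd h l) h = l by apply/ffunP => j; rewrite !ffunE addrC addKr.
  by rewrite /ind -Zsub_eq0 e.
have bQ : (\esum_(h in [set: Zvec d]) (b h * Q h)%:E = x%:E)%E.
  by rewrite -hS; apply: eq_esum => h _; rewrite QS EFinM.
have bQ0 h : 0 <= b h * Q h by apply: mulr_ge0 => //; exact: b_ge0.
have mr0 h : 0 <= modC (c h) ^+ 2 * r h by rewrite mulr_ge0 ?sqr_ge0// ltW.
(* Termwise comparison: outside the index set 1 <= r(h) / M bounds the truncation by the first part;
   inside it the aliasing error is at most Q(h) <= M b(h) Q(h). *)
apply: (@le_trans _ _ (\esum_(h in [set: Zvec d])
   (M^-1 * (modC (c h) ^+ 2 * r h) + M * (b h * Q h))%:E)%E); last first.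
  under eq_esum do rewrite EFinD.
  rewrite esumD => [|h _|h _]; last 2 first.
  - by rewrite lee_fin mulr_ge0// invr_ge0 ltW.
  - by rewrite lee_fin mulr_ge0// ltW.
  rewrite !esumZl_real ?invr_ge0 ?(ltW M0)// bQ EFinD -EFinM leeD2r//.
  rewrite -[leRHS]mule1 lee_wpmul2l// lee_fin invr_ge0 ltW//.
apply: le_esum => h _; rewrite lee_fin.
rewrite /c' /fa; case: ifPn => [rM|]; last first.
  rewrite -ltNge subr0 => Mr.
  apply: (@le_trans _ _ (M^-1 * (modC (c h) ^+ 2 * r h))); last by rewrite lerDl mulr_ge0// ltW.
  by rewrite ler_pdivlMl// mulrC ler_wpM2l ?sqr_ge0// ltW.
apply: (@le_trans _ _ (M * (b h * Q h))); last by rewrite lerDr mulr_ge0// invr_ge0 ltW.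
rewrite modC_sqr ReD ImD ReN ImN faRe faIm.
have hr := alias_sqr reA (_ : _ <= Kr%:E)%E (hQ h).
have hi := alias_sqr imA (_ : _ <= Ki%:E)%E (hQ h).
apply: le_trans (lerD (hr _) (hi _)) _; rewrite ?hKr ?hKi//.
rewrite -mulrDl -/(Q h) [leRHS]mulrA; apply: ler_wpM2r => //.
exact: le_trans knE (Mb h rM).
Qed.

End aliasing.

End lattice_error.

(** * The worst-case error *)

Section worst_case.
Context {R : realType} (n d : nat) (alpha : R) (gamma : {fset nat} -> R) (z : 'I_d -> nat).
Hypotheses (n0 : (0 < n)%N) (d0 : (0 < d)%N) (a1 : 1 < alpha) (g0 : forall u, 0 < gamma u).

(** Positivity makes [M] a positive real when S is finite. The vector with first coordinate [n] and
    zeros elsewhere is dual to every [z], so the term at h = 0 is already positive. *)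
Lemma Ssum_gt0 : (0 < Ssum n alpha gamma z)%E.
Proof.
have b0 (p : Zvec d) : 0 < (rfun alpha gamma p)^-1 by rewrite rfun_inv wt_gt0.
pose l0 : Zvec d := zupd (Zzero d) (Ordinal d0) n%:Z.
have l0n : l0 != Zzero d.
  apply/eqP => /(congr1 (fun f : Zvec d => f (Ordinal d0))).
  by rewrite zupd_id ffunE => /eqP; rewrite eqz_nat -[_ == _]negbK -lt0n n0.
have l0d : dual_cond n z l0.
  rewrite /dual_cond (bigD1 (Ordinal d0))//= zupd_id rpredDl ?dvdz_mulr//.
  by rewrite big1 ?dvdz0// => j jn; rewrite zupdE (negbTE jn) ffunE mul0r.
have inner : ((rfun alpha gamma (Zadd (Zzero d) l0))^-1%:E <=
   \esum_(l in [set l : Zvec d | l != Zzero d /\ dual_cond n z l])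
       ((rfun alpha gamma (Zadd (Zzero d) l))^-1%R)%:E)%E.
  rewrite -[leLHS](@esum_set1 _ _ l0 (fun l => ((rfun alpha gamma (Zadd (Zzero d) l))^-1)%:E)).
    by apply: le_esum_subset => [l -> //|l _]; rewrite lee_fin ltW.
  by rewrite lee_fin ltW.
pose G (h : Zvec d) : \bar R := (((rfun alpha gamma h)^-1%R)%:E *
    \esum_(l in [set l : Zvec d | l != Zzero d /\ dual_cond n z l])
       ((rfun alpha gamma (Zadd h l))^-1%R)%:E)%E.
have G0 h : (0 <= G h)%E.
  apply: mule_ge0; first by rewrite lee_fin ltW.
  by apply: esum_ge0 => l _; rewrite lee_fin ltW.
apply: (@lt_le_trans _ _ (G (Zzero d))).
  by apply: mule_gt0; [rewrite lte_fin|apply: lt_le_trans inner; rewrite lte_fin].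
rewrite -[leLHS](esum_set1 (G0 _)).
exact: le_esum_subset.
Qed.

Lemma wce_app_le :
  (wce_app n alpha gamma (fine (Ssum n alpha gamma z) `^ (- (1 / 2))) z <=
    (Num.sqrt 2)%:E * poweR (Ssum n alpha gamma z) (1 / 4))%E.
Proof.
have := Ssum_gt0; case hS : (Ssum n alpha gamma z) => [x| |]// x0; last first.
  by rewrite eqy_poweR// gt0_muley ?lte_fin ?sqrtr_gt0// leey.
rewrite lte_fin in x0.
apply: ge_ereal_sup => _ [f [[fin hf] hK] <-]; rewrite [poweR _ _]/= -EFinM lee_fin.
set A := fun h => `|complex.Re (fourier f h)| + `|complex.Im (fourier f h)|.
have [C hC] : exists C : R, (\esum_(h in [set: Zvec d]) (A h)%:E = C%:E)%E.
  eexists; apply/esym/fineK; rewrite ge0_fin_numE; last first.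
    by apply: esum_ge0 => h _; rewrite lee_fin addr_ge0.
  apply: (@le_lt_trans _ _ (2%:E * \esum_(h in [set: Zvec d]) (modC (fourier f h))%:E)%E).
    rewrite -esumZl// => [|h _]; last by rewrite lee_fin sqrtr_ge0.
    apply: le_esum => h _; rewrite -EFinM lee_fin mulr_natl mulr2n.
    by rewrite lerD ?Re_le_modC ?Im_le_modC.
  by rewrite lte_mul_pinfty.
have M0 : 0 < x `^ (- (1 / 2)) by exact: powR_gt0.
have := lattice_L2_bound n0 a1 g0 hC hf M0 hS hK.
set I := iint _ => hI.
(* With M = x^(-1/2) the truncation term 1/M and the aliasing term M x are equal, both being
   x^(1/2). *)
have E : (x `^ (- (1 / 2)))^-1 + x `^ (- (1 / 2)) * x = 2 * x `^ (1 / 2).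
  rewrite -powRN opprK -[X in _ + _ * X](powRr1 (ltW x0)) -powRD; last first.
    by rewrite (gt_eqF x0) implybT.
  by rewrite (_ : - (1 / 2) + 1 = 1 / 2); [ring|field].
rewrite /L2norm -/I (le_trans (ler_wsqrtr hI))// E sqrtrM//.
rewrite -[X in _ * X <= _](powR12_sqrt (powR_ge0 _ _)) -powRrM.
by rewrite (_ : 1 / 2 / 2 = 1 / 4)//; field.
Qed.

End worst_case.

(** * Constants independent of the dimension *)

Section dimension_free.
Context {R : realType} (gamma : {fset nat} -> R).

(** From exp t >= 1 + t at t = m/e - 1 one gets m <= exp (m/e). This is the origin of the constant
    e^(1/e): it absorbs the size factor into the [m]-th power. *)
Lemma maxn1_le_expR (m : nat) : (maxn m 1)%:R <= expR (expR (-1)) ^+ m :> R.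
Proof.
rewrite -expRM_natl.
have [m1|m0] := ltnP 0 m; last first.
  by move: m0; rewrite leqn0 => /eqP ->; rewrite mul0r expR0.
rewrite (maxn_idPl m1).
have h := expR_ge1Dx (m%:R * expR (-1) - 1 : R).
rewrite addrC subrK expRD in h.
by rewrite -(ler_pM2r (expR_gt0 (-1))).
Qed.

Lemma fvals_inj d : injective (@fvals d).
Proof.
move=> u v e; apply/setP => j; have := congr1 (fun A : {fset nat} => val j \in A) e.
by rewrite !(mem_imfset _ _ val_inj).
Qed.

Lemma wsum_le_esum (alpha lambda : R) (d : nat) : 1 < alpha * lambda ->
  ((wsum alpha gamma d lambda)%:E <=
   \esum_(u in [set: {fset nat}])
     (gamma u `^ lambda * (2 * expR (expR (-1)) * zeta (alpha * lambda)) ^+ #|` u|)%:E)%E.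
Proof.
move=> al; have z0 := zeta_ge0 al.
pose F (u : {fset nat}) : R :=
  gamma u `^ lambda * (2 * expR (expR (-1)) * zeta (alpha * lambda)) ^+ #|` u|.
apply: (@le_trans _ _ (\sum_(u : {set 'I_d}) F (fvals u))%:E).
  rewrite lee_fin; apply: ler_sum => u _.
  have E : (2 * expR (expR (-1)) * zeta (alpha * lambda)) ^+ #|u| =
      expR (expR (-1)) ^+ #|u| * (2 * zeta (alpha * lambda)) ^+ #|u|.
    by rewrite -exprMn; congr (_ ^+ _); ring.
  rewrite /F card_fvals E -[leLHS]mulrA [leLHS]mulrCA ler_wpM2l ?powR_ge0//.
  by rewrite ler_wpM2r ?maxn1_le_expR// exprn_ge0// mulr_ge0.
(* Distinct subsets of the coordinates are distinct finite sets of naturals, so the sum over them is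
   a finite partial sum of the series, whatever [d] is. *)
rewrite -sumEFin -big_enum /= -(big_map (@fvals d) xpredT (fun u => (F u)%:E)).
by apply: seq_le_esum; rewrite map_inj_uniq ?enum_uniq//; exact: fvals_inj.
Qed.

End dimension_free.

Theorem theorem2 (R : realType) (n d : nat) (alpha : R)
    (gamma : {fset nat} -> R) (z : 'I_d -> nat) :
  (2 <= n)%N -> (1 <= d)%N -> 1 < alpha ->
  (forall u, 0 < gamma u) -> gamma fset0 = 1 ->
  is_CBC n alpha gamma z ->
  let S := Ssum n alpha gamma z in
  let M := fine S `^ (- (1 / 2)) in
  (* main error bound, for every lambda in (1/alpha, 1] *)
  (forall lambda : R, 1 / alpha < lambda <= 1 ->
     let kappa := 2 `^ (2 * alpha * lambda + 1) + 1 in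
     (wce_app n alpha gamma M z <= (Num.sqrt 2)%:E * poweR S (1 / 4))%E /\
     ((Num.sqrt 2)%:E * poweR S (1 / 4) <=
        (Num.sqrt 2 * kappa `^ (1 / (4 * lambda))
         / (totient n)%:R `^ (1 / (4 * lambda))
         * wsum alpha gamma d lambda `^ (1 / (2 * lambda)))%:E)%E)
  /\
  (* the constant is independent of d under the summability condition *)
  (forall delta : R, 0 < delta ->
     let lambda := 1 / (alpha - 4 * delta) in
     1 / alpha < lambda <= 1 ->
     (\esum_(u in [set: {fset nat}])
        (gamma u `^ (1 / (alpha - 4 * delta)) *
         (2 * expR (expR (-1)) * zeta (alpha / (alpha - 4 * delta)))
           ^+ #|` u|)%:E < +oo)%E ->
     let kappa := 2 `^ (2 * alpha * lambda + 1) + 1 in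
     exists C : R, forall d' : nat,
       Num.sqrt 2 * kappa `^ (1 / (4 * lambda))
         * wsum alpha gamma d' lambda `^ (1 / (2 * lambda)) <= C).
Proof.
move=> n2 d1 a1 g0 _ cbc S M.
have ap : 0 < alpha by exact: lt_trans a1.
have lam (l : R) : 1 / alpha < l -> 0 < l /\ 1 < alpha * l.
  move=> h; split; first by apply: lt_trans h; rewrite divr_gt0.
  by move: h; rewrite ltr_pdivrMr// mulrC.
split.
  move=> lambda /andP[/lam[l0 al] l1] kappa; split.
    by apply: wce_app_le => //; exact: leq_trans n2.
  by apply: cbc_error_bound => //; rewrite l0.
move=> delta delta0 lambda /andP[/lam[l0 al] l1].
rewrite -/lambda.
have -> : alpha / (alpha - 4 * delta) = alpha * lambda by rewrite /lambda div1r.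
set E := (\esum_(u in _) _)%E => Efin kappa.
have E0 : (0 <= E)%E.
  apply: esum_ge0 => u _; rewrite lee_fin mulr_ge0 ?powR_ge0// exprn_ge0//.
  by rewrite mulr_ge0 ?zeta_ge0// mulr_ge0// expR_ge0.
(* The series [E] dominates every [wsum], uniformly in [d']. *)
exists (Num.sqrt 2 * kappa `^ (1 / (4 * lambda)) * fine E `^ (1 / (2 * lambda))) => d'.
rewrite ler_wpM2l ?mulr_ge0 ?sqrtr_ge0 ?powR_ge0//.
have W0 : 0 <= wsum alpha gamma d' lambda by exact: wsum_ge0.
apply: ge0_ler_powR; rewrite ?nnegrE ?fine_ge0//.
  by rewrite divr_ge0// mulr_ge0// ltW.
rewrite -lee_fin fineK ?ge0_fin_numE//.
exact: wsum_le_esum.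
Qed.
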